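(* Suppose that $G$ contracts the fibers: there is $0<\alpha<1$ such that for $m$-almost every $\underline{x}\in\Sigma_A^+$ one has $d(G(\underline{x},y_1),G(\underline{x},y_2))\le \alpha\, d(y_1,y_2)$ for all $y_1,y_2\in K$. Then there exists a unique $F$-invariant probability measure $\mu_0\in S^\infty$, and it satisfies $\|\mu_0\|_\infty=1$ and $\|\mu_0\|_{S^\infty}=2$.
   Context: Base. Let $A$ be an aperiodic $N\times N$ matrix with entries in $\{0,1\}$ (some power of $A$ has all entries positive), $\Sigma_A^+=\{\underline{x}=(x_i)_{i\ge 0}: x_i\in\{1,\dots,N\},\ A_{x_ix_{i+1}}=1\ \forall i\}$, with the metric $d_\theta(\underline{x},\underline{y})=\sum_{i\ge0}\theta^i(1-\delta(x_i,y_i))$, where $\theta\in(0,1)$ is fixed and $\delta(a,b)=1$ if $a=b$, $0$ otherwise. Let $\sigma$ be the left shift on $\Sigma_A^+$ and $m$ a Markov measure associated to $(\Sigma_A^+,\sigma)$ (the $\sigma$-invariant probability given by a stochastic matrix $(p_{ij})$ with $p_{ij}>0$ iff $A_{ij}=1$ and its stationary probability vector). For $\varphi:\Sigma_A^+\to\mathbb{R}$ let $|\varphi|_\theta$ be its Lipschitz constant with respect to $d_\theta$, $\mathcal{F}_\theta(\Sigma_A^+)=\{\varphi:|\varphi|_\theta<\infty\}$, $\|\varphi\|_\theta=\|\varphi\|_\infty+|\varphi|_\theta$. Skew product. $(K,d)$ is a compact metric space with $\operatorname{diam}(K)=1$; $\Sigma:=\Sigma_A^+\times K$; $G:\Sigma\to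 K$ is measurable (Borel) and $F:\Sigma\to\Sigma$ is $F(\underline{x},y)=(\sigma(\underline{x}),G(\underline{x},y))$. Put $\gamma_{\underline{x}}=\{\underline{x}\}\times K$, $\pi_1(\underline{x},y)=\underline{x}$, $\pi_2(\underline{x},y)=y$, and let $\pi_1^*$, $\pi_2^*$ denote push-forward of measures. Spaces of measures. For a finite signed Borel measure $\nu$ on a compact metric space $X$, $\|\nu\|_W=\sup\{|\int g\,d\nu| : g:X\to\mathbb{R}\text{ Lipschitz with constant}\le1,\ \|g\|_\infty\le1\}$. Let $\mathcal{AB}$ be the set of finite signed Borel measures $\mu$ on $\Sigma$, with Jordan decomposition $\mu=\mu^+-\mu^-$, such that $\pi_1^*\mu^+\ll m$ and $\pi_1^*\mu^-\ll m$; write $\phi_1=\frac{d(\pi_1^*\mu)}{dm}$. For positive $\mu\in\mathcal{AB}$ let $\{\mu_{\gamma_{\underline{x}}}\}$ be its Rokhlin disintegration along the leaves: probabilities on $\Sigma$ with $\mu_{\gamma_{\underline{x}}}(\gamma_{\underline{x}})=1$ for $\phi_1m$-a.e. $\underline{x}$, $\underline{x}\mapsto\mu_{\gamma_{\underline{x}}}(E)$ measurable, and $\mu(E)=\int\mu_{\gamma_{\underline{x}}}(E)\phi_1(\underline{x})\,dm(\underline{x})$ for all measurable $E\subset\Sigma$. The restriction of positive $\mu$ to $\gamma_{\underline{x}}$ is the positive measure on $K$ given by $\mu|_{\gamma_{\underline{x}}}(B)=\phi_1(\underline{x})\,\mu_{\gamma_{\underline{x}}}(\pi_2^{-1}(B))$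 (zero where $\phi_1(\underline{x})=0$); for signed $\mu\in\mathcal{AB}$, $\mu|_{\gamma_{\underline{x}}}:=\mu^+|_{\gamma_{\underline{x}}}-\mu^-|_{\gamma_{\underline{x}}}$. Set $\|\mu\|_\infty=\operatorname{ess\,sup}_{\underline{x}}\|\mu|_{\gamma_{\underline{x}}}\|_W$ (with respect to $m$), $\mathcal{L}^\infty=\{\mu\in\mathcal{AB}:\|\mu\|_\infty<\infty\}$, $S^\infty=\{\mu\in\mathcal{L}^\infty:\phi_1\in\mathcal{F}_\theta(\Sigma_A^+)\}$ and $\|\mu\|_{S^\infty}=\|\phi_1\|_\theta+\|\mu\|_\infty$. *)

(* Defs.v *)
From HB Require Import structures.
From mathcomp Require Import all_boot all_order all_algebra.
From mathcomp Require Import all_classical all_reals all_analysis.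
From mathcomp Require Import measurable_realfun ess_sup_inf.

Set Implicit Arguments.
Unset Strict Implicit.
Unset Printing Implicit Defensive.
Import Order.TTheory GRing.Theory Num.Theory.
Import numFieldNormedType.Exports.

Local Open Scope classical_set_scope.
Local Open Scope ring_scope.

(* Measurable types are pointed in the library, hence this join; a metric space
   of diameter 1 is nonempty, so pointing it loses nothing. *)
#[short(type="pmetricType")]
HB.structure Definition PointedMetric (R : numDomainType) :=
  { T of Metric R T & Pointed T }.

Definition borel (R : numDomainType) (T : pmetricType R) : measurableType _ :=
  g_sigma_algebraType (@open T).

Section metric_functions.
Context (R : realType) (T : pmetricType R).
Implicit Type f : T -> R.

Definition diam : \bar R :=
  ereal_sup [set (mdist x y)%:E | x in [set: T] & y in [set: T]].

Definition sup_norm f : \bar R := ereal_sup [set `|f x|%:E | x in [set: T]].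

(* The diagonal is harmless, as [0 / 0 = 0]; it makes the constant 0, and not
   -oo, on a one-point space. *)
Definition lip_const f : \bar R :=
  ereal_sup [set (`|f x - f y| / mdist x y)%:E | x in [set: T] & y in [set: T]].

Definition lipschitz_fun f := (lip_const f < +oo)%E.

Definition lip_norm f : \bar R := (sup_norm f + lip_const f)%E.

End metric_functions.

Record aperiodicMx (n : nat) := AperiodicMx {
  amx :> 'M[nat]_n.+1;
  amx01 : forall i j, amx i j = 0%N \/ amx i j = 1%N;
  amx_aperiodic : exists2 k, (0 < k)%N & forall i j, (0 < (amx ^+ k) i j)%N
}.

(* [theta] does not constrain the points: it selects the metric. *)
Record sft (R : realType) (theta : {itv R & `]0, 1[}) (n : nat)
    (A : aperiodicMx n) := Sft {
  sft_seq :> nat -> 'I_n.+1;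
  sft_adm : forall i, A (sft_seq i) (sft_seq i.+1) = 1%N
}.

HB.instance Definition _ R theta n A := gen_eqMixin (@sft R theta n A).
HB.instance Definition _ R theta n A := gen_choiceMixin (@sft R theta n A).

Section sft.
Context (R : realType) (theta : {itv R & `]0, 1[}) (n : nat)
  (A : aperiodicMx n).
Local Notation S := (sft theta A).
Implicit Types x y z : S.

Lemma sft_eqP x y : (forall i, x i = y i) -> x = y.
Proof.
case: x y => [x hx] [y hy] /= xy.
have exy : x = y by apply/funext.
by subst y; congr Sft; exact: Prop_irrelevance.
Qed.

Lemma amx_succ (i : 'I_n.+1) : exists j, A i j == 1%N.
Proof.
have [[//|k] _ Ak] := amx_aperiodic A.
have := Ak i i; rewrite exprS -[amx A * _]/(amx A *m _) mxE => s0.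
apply: contrapT => /forallNP Ai0; move: s0; rewrite big1// => j _.
by have [-> | /eqP/Ai0] := amx01 A i j; rewrite ?mul0r.
Qed.

Lemma sft_inhabited : exists x : S, True.
Proof.
pose f i := xchoose (amx_succ i).
have fA i : A (iter i f ord0) (iter i.+1 f ord0) = 1%N.
  exact/eqP/(xchooseP (amx_succ _)).
by exists (@Sft R theta n A (fun i => iter i f ord0) fA).
Qed.

HB.instance Definition _ := isPointed.Build S (projT1 (cid sft_inhabited)).

Definition dterm x y (i : nat) : R := theta%:num ^+ i * (x i != y i)%:R.

Definition dtheta x y : R := limn (series (dterm x y)).

Lemma dterm_ge0 x y i : 0 <= dterm x y i.
Proof. by rewrite /dterm mulr_ge0// exprn_ge0. Qed.

Lemma is_cvg_dterm x y : cvgn (series (dterm x y)).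
Proof.
apply: (@series_le_cvg _ (dterm x y) (geometric 1 theta%:num)).
- exact: dterm_ge0.
- by move=> i; rewrite /= mul1r exprn_ge0.
- by move=> i; rewrite /= mul1r /dterm ler_piMr ?exprn_ge0// lern1 leq_b1.
- by apply: is_cvg_geometric_series; rewrite ger0_norm.
Qed.

Lemma dterm_le_dtheta x y i : dterm x y i <= dtheta x y.
Proof.
have nd : nondecreasing_seq (series (dterm x y)).
  by apply: nondecreasing_series => // k _ _; exact: dterm_ge0.
apply: le_trans (nondecreasing_cvgn_le nd (@is_cvg_dterm x y) i.+1).
by rewrite seriesSr lerDr /series/= sumr_ge0// => k _; exact: dterm_ge0.
Qed.

Lemma dthetaxx x : dtheta x x = 0.
Proof.
rewrite /dtheta; apply: lim_near_cst => //; apply: nearW => k.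
by rewrite /series/= big1// => i _; rewrite /dterm eqxx mulr0.
Qed.

Lemma dtheta_eq0 x y : dtheta x y = 0 -> x = y.
Proof.
move=> d0; apply: sft_eqP => i; apply/eqP/negPn/negP => xy.
have := dterm_le_dtheta x y i; rewrite d0 /dterm xy mulr1 leNgt.
by rewrite exprn_gt0.
Qed.

Lemma dtheta_sym x y : dtheta x y = dtheta y x.
Proof.
by congr (limn (series _)); apply/funext => i; rewrite /dterm eq_sym.
Qed.

Lemma dtheta_triangle y x z : dtheta x z <= dtheta x y + dtheta y z.
Proof.
have cvgs := @is_cvg_dterm; rewrite /dtheta -limD; [|exact: cvgs..].
apply: ler_lim; [exact: cvgs|apply: is_cvgD; exact: cvgs|].
apply: nearW => k /=.
change (series (dterm x z) k <= series (dterm x y) k + series (dterm y z) k).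
rewrite /series/= -big_split/= ler_sum// => i _.
rewrite /dterm -mulrDr ler_wpM2l ?exprn_ge0//.
have [->|_] := eqVneq (x i) (y i); first by rewrite add0r.
by rewrite -natrD ler_nat; case: eqP; case: eqP.
Qed.

HB.instance Definition _ := isMetric.Build R S dthetaxx dtheta_eq0
  dtheta_sym dtheta_triangle.

Lemma sft_shift_adm x i : A (x i.+1) (x i.+2) = 1%N.
Proof. exact: sft_adm. Qed.

Definition sft_shift x : S :=
  @Sft R theta n A (fun i => x i.+1) (sft_shift_adm x).

Definition is_markov (m : probability (borel S) R) :=
  exists (P : 'M[R]_n.+1) (p : 'rV[R]_n.+1),
  [/\ (forall i j, 0 <= P i j) /\ (forall i, \sum_j P i j = 1),
      forall i j, 0 < P i j <-> A i j = 1%N,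
      (forall i, 0 <= p 0 i) /\ \sum_i p 0 i = 1,
      p *m P = p &
      forall (a : nat -> 'I_n.+1) (k : nat),
        m [set x | forall i, (i <= k)%N -> x i = a i] =
        (p 0 (a 0%N) * \prod_(i < k) P (a i) (a i.+1))%:E].

End sft.

Section charges.
Local Open Scope ereal_scope.
Context d (T : measurableType d) (R : realType).
Implicit Type nu : {charge set T -> \bar R}.

Definition hahn_pos nu := projT1 (cid (Hahn_decomposition nu)).

Definition hahn_neg nu :=
  projT1 (cid (projT2 (cid (Hahn_decomposition nu)))).

Definition hahnP nu : hahn_decomposition nu (hahn_pos nu) (hahn_neg nu) :=
  projT2 (cid (projT2 (cid (Hahn_decomposition nu)))).

Definition cpos nu : {finite_measure set T -> \bar R} := jordan_pos (hahnP nu).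

Definition cneg nu : {finite_measure set T -> \bar R} := jordan_neg (hahnP nu).

Definition cintegral nu (g : T -> R) : \bar R :=
  \int[cpos nu]_x (g x)%:E - \int[cneg nu]_x (g x)%:E.

Definition cpushforward d' (T' : measurableType d') (f : T -> T')
    (mf : measurable_fun setT f) nu : {charge set T' -> \bar R} :=
  measure_function_pushforward__canonical__charge_Charge nu mf.

End charges.

Definition wnorm (R : realType) (X : pmetricType R)
    (nu : {charge set (borel X) -> \bar R}) : \bar R :=
  ereal_sup [set `|cintegral nu g|%E | g in
    [set g : X -> R | (forall x y, `|g x - g y| <= mdist x y) /\
                      (forall x, `|g x| <= 1)]].

(* [S * K] carries the product sigma-algebra; for K compact both factors are
   second countable, so it is the Borel sigma-algebra of the product. *)
Section leaves.
Local Open Scope ereal_scope.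
Context (R : realType) (n : nat) (A : aperiodicMx n)
  (theta : {itv R & `]0, 1[}%R) (K : pmetricType R).
Local Notation S := (borel (sft theta A)).
Local Notation SK := (borel (sft theta A) * borel K)%type.
Variable m : probability S R.
Implicit Type mu : {charge set SK -> \bar R}.

Definition push1 (mu : {charge set SK -> \bar R}) :
  {charge set S -> \bar R} := cpushforward measurable_fst mu.

Definition push2 (mu : {charge set SK -> \bar R}) :
  {charge set (borel K) -> \bar R} := cpushforward measurable_snd mu.

Definition density (mu : {charge set SK -> \bar R}) : S -> \bar R :=
  Radon_Nikodym (push1 mu) m.

Definition is_disintegration (mu : {finite_measure set SK -> \bar R})
    (k : S -> probability SK R) :=
  let phi := density (charge_of_finite_measure mu) in
  [/\ \forall x \ae m, phi x != 0 -> k x ([set x] `*` setT) = 1,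
      forall E, measurable E -> measurable_fun setT (k ^~ E) &
      forall E, measurable E -> mu E = \int[m]_x (k x E * phi x)].

(* By Rokhlin's theorem a disintegration exists and is unique up to a null set
   of leaves, so neither the default value nor the choice matters. *)
Definition leaf_restr_pos (mu : {finite_measure set SK -> \bar R}) :
    S -> {charge set (borel K) -> \bar R} :=
  match pselect (exists k, is_disintegration mu k) with
  | left h => let k := projT1 (cid h) in fun x =>
      cscale (fine (density (charge_of_finite_measure mu) x))
             (push2 (charge_of_finite_measure (k x)))
  | right _ => fun=> czero
  end.

Definition leaf_restr mu (x : S) : {charge set (borel K) -> \bar R} :=
  cadd (leaf_restr_pos (cpos mu) x) (copp (leaf_restr_pos (cneg mu) x)).

Definition in_AB mu :=
  push1 (charge_of_finite_measure (cpos mu)) `<< m /\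
  push1 (charge_of_finite_measure (cneg mu)) `<< m.

Definition Linf_norm mu : \bar R :=
  ess_sup m (fun x => wnorm (leaf_restr mu x)).

Definition in_Linf mu := in_AB mu /\ Linf_norm mu < +oo.

(* [density] is only defined up to [m]-null sets, so belonging to F_theta is
   understood of one of its versions; [m] having full support, this version is
   unique, and the infimum in [Sinf_norm] is over a singleton. *)
Definition is_lip_version mu (phi : sft theta A -> R) :=
  lipschitz_fun phi /\ \forall x \ae m, density mu x = (phi x)%:E.

Definition in_Sinf mu := in_Linf mu /\ exists phi, is_lip_version mu phi.

Definition Sinf_norm mu : \bar R :=
  ereal_inf [set lip_norm phi | phi in [set phi | is_lip_version mu phi]] +
  Linf_norm mu.

Definition skew_product (G : SK -> borel K) (z : SK) : SK := (sft_shift z.1, G z).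

(* Equality is required on measurable sets only, the values of a measure being
   irrelevant elsewhere. *)
Definition invariant_measure (F : SK -> SK) (mu : probability SK R) :=
  forall E, measurable E -> pushforward mu F E = mu E.

End leaves.

(* Main.v *)
From HB Require Import structures.
Require Import Defs.
From mathcomp Require Import all_boot all_order all_algebra.
From mathcomp Require Import all_classical all_reals all_analysis.
From mathcomp Require Import measurable_realfun ess_sup_inf ring lra.
Import Order.TTheory GRing.Theory Num.Theory.
Import numFieldNormedType.Exports.

(** Call [m] the Markov measure and [sigma] the shift.

    Marginals.  If [mu] is invariant under the skew product, then its marginal
    is [sigma]-invariant, and if [mu] is in S^infty it has a Lipschitz density
    [phi] with respect to [m].  Such a density is constant.  For a real [t], the
    set E = {phi > t} and its preimage sigma^-1 E have the same mass, both for
    [m] and for [phi m], which is possible only if {phi > t >= phi o sigma} is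
    [m]-negligible; as [m] charges every cylinder and [phi] is continuous, phi
    <= phi o sigma everywhere.  Thus [phi] does not increase when a symbol is
    prepended, and the points obtained from any given point by prepending
    symbols are dense because [A] is aperiodic
    ([invariant_lipschitz_density]).  So the marginal is [m].

    Uniqueness.  Two points of a leaf are at distance at most [alpha ^+ k] after
    [k] iterations.  Hence, for an invariant [mu] of marginal [m], the mass of a
    product [C `*` U] with [U] open is, up to shrinking [U] by [alpha ^+ k], the
    [m]-mass of the base points [x] for which the k-th iterate of [(x, y0)] is
    in [C `*` U]; this depends on [m] only ([invariant_unique]).

    Existence, with a disintegration.  The measure on the leaf over [x] has to
    be the law of the limit of G(z_1, G(z_2, ..., G(z_k, y0))), where [z_1],
    [z_2], etc. is a random backward trajectory of [x] under [sigma], run with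
    the transition probabilities of the reversed Markov chain.  All the
    randomness is encoded in one uniform variable [u] of ]0, 1]: the cell of a
    partition of ]0, 1] containing [u] selects the symbol to prepend, and [u]
    rescaled to this cell is again uniform and independent of this symbol.  This
    gives a map [backward_step] of the pairs [(x, u)] which is a random inverse
    branch of [sigma] and preserves the product of [m] and the uniform law
    ([backward_step_preserves]).  By contraction there is a measurable [Y] with
    Y (x, u) = G (z, Y (z, v)) whenever [(z, v)] is the backward step of
    [(x, u)] ([invariant_section]).  The law of [(x, Y (x, u))] is then
    invariant, has marginal [m], and is disintegrated by the laws of
    [Y (x, u)] for fixed [x].

    Norms.  The leafwise restrictions of this measure are almost surely
    probabilities, whose dual Lipschitz norm is 1, and its density is 1.

    As [G] contracts almost every leaf only, uniqueness and existence are first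
    obtained for the map which is constant on a negligible set of leaves and
    equal to [G] elsewhere: both maps have the same invariant measures of
    marginal [m]. *)

Set Implicit Arguments.
Unset Strict Implicit.
Unset Printing Implicit Defensive.

Local Open Scope classical_set_scope.
Local Open Scope ring_scope.

(** * Measures *)

Section image.
Context d d' (T : measurableType d) (T' : measurableType d') (R : realType).
Context (f : T -> T') (mf : measurable_fun setT f).

Definition image_measure (mu : {measure set T -> \bar R}) :
  {measure set T' -> \bar R} :=
  measure_function_pushforward__canonical__measure_function_Measure mu mf.

Definition image_prob (mu : probability T R) : probability T' R :=
  distribution mu (mfun_Sub (mem_set mf) : {RV mu >-> T'}).

End image.

Lemma measure_eq_off d (T : measurableType d) (R : realType)
    (mu : {measure set T -> \bar R}) (B C Z : set T) :
  measurable B -> measurable C -> measurable Z -> mu Z = 0%E ->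
  B `\` Z = C `\` Z -> mu B = mu C.
Proof.
move=> mB mC mZ Z0 BC.
have off D : measurable D -> mu (D `&` Z) = 0%E.
  move=> mD; apply/eqP; rewrite eq_le measure_ge0 andbT -Z0.
  by apply: le_measure; rewrite ?inE//; exact: measurableI.
rewrite [LHS](measureDI mu mB mZ) [RHS](measureDI mu mC mZ) BC; congr (_ + _)%E.
by transitivity (0%E : \bar R); [exact: off|exact/esym/off].
Qed.

(** * Metric spaces *)

Lemma lipschitz_fun_bound (R : realType) (T : pmetricType R) (f : T -> R) :
  lipschitz_fun f -> exists2 L, 0 <= L & forall x y, `|f x - f y| <= L * mdist x y.
Proof.
rewrite /lipschitz_fun => foo.
have ub x y : ((`|f x - f y| / mdist x y)%:E <= lip_const f)%E.
  by apply: ereal_sup_ubound; exists x => //; exists y.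
have f0 : (0 <= lip_const f)%E by have := ub point point; rewrite subrr normr0 mul0r.
have ff : lip_const f \is a fin_num by rewrite ge0_fin_numE.
exists (fine (lip_const f)); first exact: fine_ge0.
move=> x y; have [->|xy] := eqVneq x y; first by rewrite subrr normr0 mdistxx mulr0.
by rewrite -ler_pdivrMr ?mdist_gt0// -lee_fin fineK.
Qed.

Section metric.
Context (R : realType) (T : pmetricType R).
Implicit Types (x y z : T) (U : set T).

Lemma measurable_lipschitz (f : T -> R) (L : R) :
  (forall x y, `|f x - f y| <= L * mdist x y) ->
  measurable_fun [set: borel T] (f : borel T -> R).
Proof.
move=> fL; apply: (measurability _ (RGenOInfty.measurableE R)) => // _ [_ [t ->] <-].
rewrite setTI; suff : open (f @^-1` `]t, +oo[ : set T) by exact: sub_sigma_algebra.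
rewrite openE => x /=.
rewrite in_itv /= andbT => tx; rewrite /interior -filter_from_ballE.
have L1 : 0 < `|L| + 1 by rewrite ltr_wpDl.
exists ((f x - t) / (`|L| + 1)); first by rewrite /= divr_gt0// subr_gt0.
rewrite ballEmdist => y /=; rewrite ltr_pdivlMr// => xy.
rewrite in_itv /= andbT; have := fL x y; rewrite ler_norml => /andP[_].
have d0 := mdist_ge0 x y.
have : L * mdist x y <= `|L| * mdist x y by rewrite ler_wpM2r// ler_norm.
by nra.
Qed.

(** The distance to the complement of [U], truncated at 1 so as to make sense
    for the whole space. *)
Definition gap U y : R := inf ([set mdist y z | z in ~` U] `|` [set 1]).

Let gap_inf U y : has_inf ([set mdist y z | z in ~` U] `|` [set 1]).
Proof.
split; first by exists 1; right.
by exists 0 => _ [[z _ <-]|->]; rewrite ?mdist_ge0.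
Qed.

Let gap_lip1 U x y : gap U x <= gap U y + mdist x y.
Proof.
rewrite -lerBlDr; apply: lb_le_inf; first by have [] := gap_inf U y.
have [_ lb] := gap_inf U x.
move=> _ [[z Uz <-]|->]; rewrite lerBlDr.
  apply: (@le_trans _ _ (mdist x z)); first by apply: ge_inf => //; left; exists z.
  by rewrite addrC metric_triangle.
apply: (@le_trans _ _ 1); first by apply: ge_inf => //; right.
by rewrite lerDl mdist_ge0.
Qed.

Lemma gap_lip U x y : `|gap U x - gap U y| <= mdist x y.
Proof.
rewrite ler_norml lerBlDr [_ + gap _ _]addrC gap_lip1 andbT.
by rewrite lerBrDr addrC lerBlDr metric_sym gap_lip1.
Qed.

Lemma gap_gt0 U y : open U -> (0 < gap U y) <-> U y.
Proof.
move=> oU; have [_ lb] := gap_inf U y; split => [gy|Uy].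
  apply: contrapT => Uy; move: gy; rewrite ltNge => /negP; apply.
  by apply: ge_inf => //; left; exists y => //; exact: mdistxx.
move: oU; rewrite openE => /(_ _ Uy); rewrite /interior -filter_from_ballE.
move=> [e /= e0]; rewrite ballEmdist => yeU.
apply: (@lt_le_trans _ _ (Num.min e 1)); first by rewrite lt_min e0 ltr01.
apply: lb_le_inf; first by have [] := gap_inf U y.
move=> _ [[z Uz <-]|->]; rewrite ge_min ?lexx ?orbT// leNgt.
by apply/orP; left; apply/negP => /yeU.
Qed.

Lemma measurable_gap U : measurable_fun [set: borel T] (gap U : borel T -> R).
Proof.
by apply: (@measurable_lipschitz _ 1) => x y; rewrite mul1r; exact: gap_lip.
Qed.

Lemma measurable_gap_gt U (e : R) : measurable ([set y | e < gap U y] : set (borel T)).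
Proof.
have := @measurable_gap U measurableT `]e, +oo[%classic (measurable_itv _).
rewrite setTI; congr measurable.
by apply/seteqP; split => y /=; rewrite in_itv /= andbT.
Qed.

(** An open set is where its gap function is positive, and the gap functions
    along the sequence are real functions converging pointwise. *)
Lemma measurable_limit d (X : measurableType d) (f : nat -> X -> borel T)
    (g : X -> borel T) :
  (forall k, measurable_fun setT (f k)) ->
  (forall x : X, (fun k => mdist (f k x : T) (g x)) @ \oo --> (0 : R)) ->
  measurable_fun setT g.
Proof.
move=> mf fg.
apply: (@measurability _ _ X (borel T) setT g (@open T)) => // _ [U oU <-].
have -> : setT `&` g @^-1` U = (gap U \o g) @^-1` `]0, +oo[%classic.
  rewrite setTI; apply/seteqP; split => x /=; rewrite in_itv /= andbT.
    by move=> /(gap_gt0 _ oU).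
  by move=> /(gap_gt0 _ oU).
suff mg : measurable_fun setT (gap U \o g).
  by rewrite -[X in measurable X]setTI; apply: mg => //; exact: measurable_itv.
apply: (@measurable_fun_cvg _ _ _ setT (fun k => gap U \o f k)) => [k|x _].
  by apply: measurableT_comp (mf k); exact: measurable_gap.
apply/cvgrPdist_le => e e0.
have /cvgrPdist_le /(_ e e0) := fg x; apply: filterS => k /=.
rewrite sub0r normrN ger0_norm ?mdist_ge0// distrC; apply: le_trans.
exact: gap_lip.
Qed.

Lemma prod_measure_unique_open d (X : measurableType d)
    (mu nu : {measure set (X * borel T) -> \bar R}) :
  (mu setT < +oo)%E ->
  (forall C U, measurable C -> open U -> mu (C `*` U) = nu (C `*` U)) ->
  forall E, measurable E -> mu E = nu E.
Proof.
move=> muoo munu.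
have rect C B : measurable C -> measurable B -> mu (C `*` B) = nu (C `*` B).
  move=> mC mB; have mCT : measurable (C `*` setT : set (X * borel T)) by exact: measurableX.
  have CTE (D : set (borel T)) : snd @^-1` D `&` C `*` setT = C `*` D :> set (X * borel T).
    by apply/seteqP; split => -[x u] /=; tauto.
  rewrite -[C `*` B]CTE.
  apply: (@measure_unique _ R (borel T) (@open T) (fun=> setT) erefl _ _ _
    (image_measure measurable_snd (mrestr mu mCT))
    (image_measure measurable_snd (mrestr nu mCT))) => //.
  - by move=> ? ?; exact: openI.
  - by move=> _; exact: openT.
  - by rewrite bigcup_const//; exists 0%N.
  - by move=> U oU; rewrite /= /pushforward /mrestr !CTE; exact: munu.
  - move=> _; apply: le_lt_trans muoo; apply: le_measure; rewrite ?inE//.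
    by rewrite CTE.
pose rects : set (set (X * borel T)) := [set A `*` B | A in measurable & B in measurable].
move=> E mE; apply: (@measure_unique _ R (X * borel T)%type rects (fun=> setT)) => //.
- by rewrite measurable_prod_measurableType.
- move=> _ _ [A mA [B mB <-]] [A' mA' [B' mB' <-]]; rewrite -setXI.
  by exists (A `&` A'); [exact: measurableI|exists (B `&` B') => //; exact: measurableI].
- by move=> _; exists setT => //; exists setT => //; rewrite setXTT.
- by rewrite bigcup_const//; exists 0%N.
- by move=> _ [A mA [B mB <-]]; exact: rect.
Qed.

Lemma geometric_cvg (u : nat -> T) (a : R) : compact [set: T] -> 0 < a < 1 ->
  (forall k, mdist (u k) (u k.+1) <= a ^+ k) -> cvgn u.
Proof.
move=> cT /andP[a0 a1] ua.
have ukl k l : mdist (u k) (u (k + l)%N) <= a ^+ k / (1 - a).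
  have : mdist (u k) (u (k + l)%N) <= a ^+ k * ((1 - a ^+ l) / (1 - a)).
    elim: l => [|l IH]; first by rewrite addn0 mdistxx expr0 subrr mul0r mulr0.
    apply: le_trans (metric_triangle _ (u (k + l)%N) _) _.
    rewrite addnS; apply: le_trans (lerD IH (ua _)) _.
    rewrite exprD -mulrDr ler_wpM2l ?exprn_ge0 ?(ltW a0)//.
    rewrite exprS le_eqVlt; apply/orP; left; apply/eqP; field.
    by rewrite subr_eq0 gt_eqF.
  move/le_trans; apply; rewrite ler_wpM2l ?exprn_ge0 ?(ltW a0)//.
  rewrite ler_piMl// ?invr_ge0 ?subr_ge0 ?(ltW a1)//.
  by rewrite lerBlDr lerDl exprn_ge0// ltW.
apply: (compact_cauchy_cvg (U := setT)) => //; last exact: filterT.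
apply: cauchy_exP => e e0.
have h : (fun k => a ^+ k / (1 - a)) @ \oo --> (0 : R).
  rewrite -[X in _ --> X](mul0r (1 - a)^-1); apply: cvgMl.
  by apply: cvg_expr; rewrite ger0_norm// ltW.
have /cvgrPdist_lt /(_ _ e0) [k _ /(_ k (leqnn _))] := h.
rewrite /= sub0r normrN => ke.
exists (u k); exists k => // l /= kl; rewrite ballEmdist /= -(subnKC kl).
apply: le_lt_trans (ukl _ _) _; apply: le_lt_trans ke; exact: ler_norm.
Qed.

End metric.

(** * Cylinders of the subshift *)

Section symbolic.
Context (R : realType) (theta : {itv R & `]0, 1[}) (n : nat)
  (A : aperiodicMx n).
Local Notation S := (sft theta A).
Local Notation I := 'I_n.+1.
Implicit Types (x y z : S) (a : nat -> I).

Lemma mdist_sftE x y : mdist x y = dtheta x y.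
Proof. by []. Qed.

Lemma dtheta_shift x y :
  dtheta x y = (x 0%N != y 0%N)%:R + theta%:num * dtheta (sft_shift x) (sft_shift y).
Proof.
rewrite /dtheta; apply/cvg_lim => //.
rewrite -(cvg_shiftS (series (dterm x y))).
have -> : [sequence (series (dterm x y)) k.+1]_k =
  fun k => (x 0%N != y 0%N)%:R
    + theta%:num * series (dterm (sft_shift x) (sft_shift y)) k.
  apply/funext => k /=; rewrite /series /= big_nat_recl// {1}/dterm expr0 mul1r.
  congr (_ + _); rewrite big_distrr /=; apply: eq_bigr => i _.
  by rewrite /dterm /= exprS mulrA.
apply: cvgD; first exact: cvg_cst.
by apply: cvgMr; exact: is_cvg_dterm.
Qed.

Lemma dtheta_le x y : dtheta x y <= (1 - theta%:num)^-1.
Proof.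
have t1 : `|theta%:num| < 1 by rewrite ger0_norm.
have gcv := @cvg_geometric_series _ 1 _ t1.
rewrite -[leRHS]mul1r -(cvg_lim (@Rhausdorff R) gcv).
apply: ler_lim; [exact: is_cvg_dterm|by apply/cvg_ex; eexists; exact: gcv|].
apply: nearW => k; rewrite /series /= ler_sum// => i _.
by rewrite /dterm mul1r ler_piMr ?exprn_ge0// lern1 leq_b1.
Qed.

(** The tail of the geometric series, by iterating [dtheta_shift]. *)
Lemma dtheta_agree x y k : (forall i, (i < k)%N -> x i = y i) ->
  dtheta x y <= theta%:num ^+ k / (1 - theta%:num).
Proof.
elim: k x y => [|k IH] x y xy; first by rewrite expr0 mul1r dtheta_le.
rewrite dtheta_shift xy// eqxx add0r exprS -mulrA ler_wpM2l//.
by apply: IH => i ik; apply: xy.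
Qed.

Lemma dtheta_lt_agree x y k : dtheta x y < theta%:num ^+ k ->
  forall i, (i <= k)%N -> x i = y i.
Proof.
move=> xyk i ik; apply/eqP/negPn/negP => xyi.
have := dterm_le_dtheta x y i; rewrite /dterm xyi mulr1 leNgt => /negP; apply.
by apply: lt_le_trans xyk _; rewrite ler_wiXn2l// ltW.
Qed.

(** Cylinders are indexed by the last constrained position, as in
    [is_markov]: [cyl a k] fixes [k.+1] symbols. *)
Definition cyl a k : set S := [set x | forall i, (i <= k)%N -> x i = a i].

Lemma open_cyl a k : open (cyl a k).
Proof.
rewrite openE => x ax; rewrite /interior /=.
rewrite -filter_from_ballE; exists (theta%:num ^+ k); first by rewrite /= exprn_gt0.
rewrite ballEmdist => y /= xy i ik; rewrite -ax//.
by apply/esym; exact: dtheta_lt_agree xy _ ik.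
Qed.

Lemma cvg_theta_bound (L : R) :
  (fun k => L * (theta%:num ^+ k / (1 - theta%:num))) @ \oo --> (0 : R).
Proof.
rewrite -[X in _ --> X](mulr0 L); apply: cvgMr.
rewrite -[X in _ --> X](mul0r (1 - theta%:num)^-1); apply: cvgMl.
by apply: cvg_expr; rewrite ger0_norm.
Qed.

Lemma open_subcyl (U : set S) x : open U -> U x -> exists k, cyl x k `<=` U.
Proof.
rewrite openE => /(_ x) /[apply]; rewrite /interior -filter_from_ballE => -[e /= e0 xeU].
have /cvgrPdist_lt /(_ _ e0) [k _ /(_ k (leqnn _)) ke] := cvg_theta_bound 1.
exists k => y xy; apply: xeU; rewrite ballEmdist /=.
have : dtheta x y <= theta%:num ^+ k / (1 - theta%:num).
  by apply: dtheta_agree => i ik; rewrite xy// ltnW.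
move/le_lt_trans; apply; move: ke; rewrite mul1r sub0r normrN.
by apply: le_lt_trans; exact: ler_norm.
Qed.

Lemma subcyl_open (U : set S) : (forall x, U x -> exists k, cyl x k `<=` U) -> open U.
Proof.
move=> Uc; rewrite openE => x /Uc [k kU].
by apply: filterS kU _; apply: open_nbhs_nbhs; split=> //; exact: open_cyl.
Qed.

Lemma measurable_shift :
  measurable_fun setT (@sft_shift R theta n A : borel S -> borel S).
Proof.
apply: (@measurability _ _ (borel S) (borel S) setT _ (@open S)) => // _ [U oU <-].
apply: measurableI => //; apply: sub_sigma_algebra; apply: subcyl_open => x Ux.
have [k kU] := open_subcyl oU Ux; exists k.+1 => y xy; apply: kU => i ik.
exact: xy.
Qed.

(** Only words of length at least two: for them, the first symbol to prepend
    and the current first symbol are both known, see [backward_step_cyl]. *)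
Definition cylinders : set (set S) :=
  [set C | C = set0 \/ exists a k, C = cyl a k.+1].

Lemma cylinders_setI : setI_closed cylinders.
Proof.
have cc a b k l : (k <= l)%N -> cylinders (cyl a k.+1 `&` cyl b l.+1).
  move=> kl; have [ab|/existsNP [i /not_implyP [ik /eqP abi]]] :=
      pselect (forall i, (i <= k.+1)%N -> a i = b i).
    right; exists b, l; apply/seteqP; split => [x []//|x bx]; split => //.
    by move=> i ik; rewrite ab// bx// (leq_trans ik).
  left; apply/seteqP; split => // x [ax bx].
  by move: abi; rewrite -ax// -bx ?eqxx// (leq_trans ik).
move=> C D [->|[a [k ->]]]; first by rewrite set0I; left.
move=> [->|[b [l ->]]]; first by rewrite setI0; left.
by have [kl|/ltnW lk] := leqP k l; [exact: cc|rewrite setIC; exact: cc].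
Qed.

Lemma measurable_cyl a k : measurable (cyl a k : set (borel S)).
Proof. by apply: sub_sigma_algebra; exact: open_cyl. Qed.

Lemma borel_sft : @measurable _ (borel S) = <<s cylinders >>.
Proof.
apply/seteqP; split; apply: smallest_sub; first exact: smallest_sigma_algebra.
- move=> U oU.
  pose wcyl (w : seq I) := cyl (nth ord0 w) (size w).-1.
  (* words rather than sequences, as there are finitely many of each length *)
  pose V k (w : k.+2.-tuple I) :=
    if pselect (wcyl w `<=` U) then wcyl w else set0.
  have -> : U = \bigcup_k \big[setU/set0]_(w : k.+2.-tuple I) V k w.
    apply/seteqP; split => [x Ux|x [k _]]; last first.
      rewrite -bigcup_seq => -[w _]; rewrite /V.
      by case: pselect => // wU /wU.
    have [k xkU] := open_subcyl oU Ux; exists k => //; rewrite -bigcup_seq.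
    exists [tuple x i | i < k.+2]; first by rewrite /= mem_index_enum.
    have wE : wcyl [tuple x i | i < k.+2] = cyl x k.+1.
      have xE (i : nat) : (i <= k.+1)%N -> nth ord0 [tuple x i | i < k.+2] i = x i.
        move=> ik; have ik2 : (i < k.+2)%N by [].
        exact: (nth_mktuple (fun i : 'I_k.+2 => x i) ord0 (Ordinal ik2)).
      rewrite /wcyl size_tuple.
      by apply/seteqP; split=> y yx i ik; rewrite yx// xE.
    rewrite /V; case: pselect => [wU|] /=; rewrite wE //.
    by case; apply: subset_trans xkU => y xy i ik; apply: xy; exact: leqW.
  change (@measurable _ (g_sigma_algebraType cylinders)
    (\bigcup_k \big[setU/set0]_(w : k.+2.-tuple I) V k w)).
  apply: bigcupT_measurable => k; apply: bigsetU_measurable => w _.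
  rewrite /V; case: pselect => wU /=; last exact: measurable0.
  apply: sub_sigma_algebra.
  by right; exists (nth ord0 w), k; rewrite /wcyl size_tuple.
- exact: smallest_sigma_algebra.
- by move=> _ [->|[a [k ->]]]; [exact: measurable0|exact: measurable_cyl].
Qed.

Lemma cyl_measure_unique (m1 m2 : {measure set (borel S) -> \bar R}) :
  (m1 setT < +oo)%E ->
  (forall a k, m1 (cyl a k.+1) = m2 (cyl a k.+1)) ->
  forall E, measurable E -> m1 E = m2 E.
Proof.
move=> m1oo m12 E mE.
pose g k : set S := if @unpickle (I * I)%type k is Some (i, j)
  then cyl (fun l => if l is 0%N then i else j) 1 else set0.
have Gg k : cylinders (g k).
  rewrite /g; case: unpickle => [[i j]|]; last by left.
  by right; exists (fun l => if l is 0%N then i else j), 0%N.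
apply: (@measure_unique _ R (borel S) cylinders g) => //.
- exact: borel_sft.
- exact: cylinders_setI.
- apply/seteqP; split => // x _; exists (pickle (x 0%N, x 1%N)) => //.
  by rewrite /g pickleK => -[//|[//|]].
- by move=> _ [->|[a [k ->]]]; rewrite ?measure0.
- move=> k; apply: le_lt_trans m1oo; apply: le_measure; rewrite ?inE//.
  by rewrite borel_sft; exact: sub_sigma_algebra.
Qed.

End symbolic.

(** * Prepending symbols, and full support of the Markov measure *)

Section prepend.
Context (R : realType) (theta : {itv R & `]0, 1[}) (n : nat)
  (A : aperiodicMx n).
Local Notation S := (sft theta A).
Local Notation I := 'I_n.+1.
Implicit Types (x y z : S) (i j : I).

(** Aperiodicity gives an admissible path from any symbol to [j0], along which
    [Q] propagates backwards. *)
Lemma aperiodic_closed (Q : I -> Prop) j0 : Q j0 ->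
  (forall i j, A i j = 1%N -> Q j -> Q i) -> forall i, Q i.
Proof.
move=> Qj0 QA; have [k _ Ak] := amx_aperiodic A.
suff H l : forall i j, (0 < (amx A ^+ l) i j)%N -> Q j -> Q i.
  by move=> i; exact: H (Ak i j0) Qj0.
elim: l => [|l IH] i j.
  by rewrite expr0 mxE; case: eqP => [->//|_]; rewrite ltnn.
rewrite exprS -[amx A * _]/(amx A *m _) mxE => s0 Qj.
have [h Ah] : exists h, (0 < A i h * (amx A ^+ l) h j)%N.
  apply: contrapT => /forallNP h0; move: s0; rewrite big1 ?ltnn// => h _.
  by have [//|/h0] := posnP (A i h * (amx A ^+ l) h j)%N.
have [Aih0|Aih] := amx01 A i h; first by move: Ah; rewrite Aih0 mul0n ltnn.
move: Ah; rewrite muln_gt0 => /andP[_ Ah].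
by apply: QA Aih _; exact: IH Ah Qj.
Qed.

Section prepend_def.
Variables (i : I) (x : S) (ix : A i (x 0%N) = 1%N).

Let sq k := if k is k'.+1 then x k' else i.

Let sq_adm k : A (sq k) (sq k.+1) = 1%N.
Proof. by case: k => [//|k]; exact: sft_adm. Qed.

Definition prepend_adm : S := Sft theta sq_adm.

End prepend_def.

Definition prepend i x : S :=
  if pselect (A i (x 0%N) = 1%N) is left h then prepend_adm h else x.

Lemma prepend0 i x : A i (x 0%N) = 1%N -> prepend i x 0%N = i.
Proof. by rewrite /prepend; case: pselect. Qed.

Lemma prependS i x k : A i (x 0%N) = 1%N -> prepend i x k.+1 = x k.
Proof. by rewrite /prepend; case: pselect. Qed.

Lemma shift_prepend i x : A i (x 0%N) = 1%N -> sft_shift (prepend i x) = x.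
Proof. by move=> ix; apply: sft_eqP => k /=; rewrite prependS. Qed.

(** Aperiodicity connects any symbol to the first symbol of [y], which gives a
    point of [Q] with prescribed first symbol; then the other symbols of the
    cylinder, being admissible, are prepended one at a time. *)
Lemma backward_dense (Q : S -> Prop) y : Q y ->
  (forall i x, A i (x 0%N) = 1%N -> Q x -> Q (prepend i x)) ->
  forall x k, exists2 z : S, cyl x k z & Q z.
Proof.
move=> Qy QA.
have H0 j : exists2 z : S, z 0%N = j & Q z.
  apply: (@aperiodic_closed (fun j => exists2 z : S, z 0%N = j & Q z) (y 0%N)).
    by exists y.
  move=> i i' ii' [z z0 Qz]; rewrite -z0 in ii'.
  by exists (prepend i z); [exact: prepend0|exact: QA].
move=> x k; elim: k x => [|k IH] x.
  by have [z z0 Qz] := H0 (x 0%N); exists z => // i; rewrite leqn0 => /eqP ->.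
have [z xz Qz] := IH (sft_shift x).
have xz0 : A (x 0%N) (z 0%N) = 1%N by rewrite xz//; exact: (sft_adm x 0).
exists (prepend (x 0%N) z); last exact: QA.
by case=> [|i] ik; [rewrite prepend0|rewrite prependS// xz].
Qed.

End prepend.

Section markov.
Context (R : realType) (theta : {itv R & `]0, 1[}) (n : nat)
  (A : aperiodicMx n).
Local Notation S := (sft theta A).
Local Notation I := 'I_n.+1.
Context (m : probability (borel S) R) (P : 'M[R]_n.+1) (p : 'rV[R]_n.+1).
Hypothesis P_gt0 : forall i j, 0 < P i j <-> A i j = 1%N.
Hypothesis P_ge0 : forall i j, 0 <= P i j.
Hypothesis p_ge0 : forall i, 0 <= p 0 i.
Hypothesis p_sum1 : \sum_i p 0 i = 1.
Hypothesis pP : p *m P = p.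
Hypothesis m_cyl : forall (a : nat -> I) (k : nat),
  m (cyl a k) = (p 0 (a 0%N) * \prod_(i < k) P (a i) (a i.+1))%:E.

(** By stationarity the null states are closed under predecessors, so there are
    none, for otherwise all of them would be null. *)
Lemma stationary_gt0 i : 0 < p 0 i.
Proof.
rewrite lt_def p_ge0 andbT; apply/eqP => pi0.
suff pz j : p 0 j = 0.
  by move: p_sum1; rewrite big1// => /eqP; rewrite eq_sym oner_eq0.
apply: (@aperiodic_closed _ A (fun j => p 0 j = 0) i pi0) => h l hl pl0.
have /eqP : (p *m P) 0 l = 0 by rewrite pP.
rewrite mxE psumr_eq0; last by move=> q _; rewrite mulr_ge0.
move=> /allP /(_ h); rewrite mem_index_enum => /(_ isT) /=.
by rewrite mulf_eq0 => /orP[/eqP//|]; rewrite gt_eqF//; apply/P_gt0.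
Qed.

Lemma cyl_gt0 (x : S) k : (0 < m (cyl x k))%E.
Proof.
rewrite m_cyl lte_fin mulr_gt0 ?stationary_gt0//.
by apply: prodr_gt0 => i _; apply/P_gt0; exact: sft_adm.
Qed.


End markov.

(** * Lipschitz densities of shift-invariant measures *)

Section density_rigidity.
Context (R : realType) (theta : {itv R & `]0, 1[}) (n : nat)
  (A : aperiodicMx n).
Local Notation S := (sft theta A).
Context (m nu : probability (borel S) R).
Hypothesis cyl_gt0 : forall (x : S) k, (0 < m (cyl x k))%E.
Let sh := (@sft_shift R theta n A : borel S -> borel S).
Hypothesis m_inv : forall E, measurable E -> m (sh @^-1` E) = m E.
Hypothesis nu_inv : forall E, measurable E -> nu (sh @^-1` E) = nu E.
Context (phi : S -> R) (L : R).
Hypothesis L0 : 0 <= L.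
Hypothesis phiL : forall x y : S, `|phi x - phi y| <= L * mdist x y.
Hypothesis nuE : forall E, measurable E -> nu E = (\int[m]_(x in E) (phi x)%:E)%E.

Let phi_near (x : S) (e : R) : 0 < e ->
  exists k, forall y, cyl x k y -> `|phi x - phi y| < e.
Proof.
move=> e0.
have /cvgrPdist_lt /(_ _ e0) [k _ /(_ k (leqnn _)) ke] := cvg_theta_bound theta L.
exists k => y xy; apply: le_lt_trans (phiL x y) _; rewrite mdist_sftE.
move: ke; rewrite sub0r normrN; apply: le_lt_trans; apply: le_trans (ler_norm _).
by apply: ler_wpM2l => //; apply: dtheta_agree => i ik; rewrite xy// ltnW.
Qed.

Let mphi : measurable_fun setT (phi : borel S -> R).
Proof. exact: measurable_lipschitz phiL. Qed.

Let measurable_gt t : measurable ([set x | t < phi x] : set (borel S)).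
Proof.
have := mphi measurableT (measurable_itv `]t, +oo[); rewrite setTI.
congr measurable.
by apply/seteqP; split => x /=; rewrite in_itv /= andbT.
Qed.

Let phi_bounded : exists M : R, forall x, `|phi x| <= M.
Proof.
exists (`|phi point| + L / (1 - theta%:num)) => x.
rewrite -[phi x](subrK (phi point)) addrC; apply: le_trans (ler_normD _ _) _.
rewrite lerD2l; apply: le_trans (phiL _ _) _.
by rewrite ler_wpM2l// mdist_sftE dtheta_le.
Qed.

Let iphi E : measurable E -> m.-integrable E (EFin \o phi).
Proof.
move=> mE; have [M Mb] := phi_bounded.
apply: measurable_bounded_integrable => //.
- by rewrite (le_lt_trans (probability_le1 _ _))// ltry.
- exact: measurable_funTS.
- exists M; split; first exact: num_real.
  by move=> x Mx y _ /=; apply: le_trans (Mb y) (ltW Mx).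
Qed.

Let nu_ge (c : R) E : measurable E -> (forall x : borel S, E x -> c <= phi x) ->
  (c%:E * m E <= nu E)%E.
Proof.
move=> mE cE; rewrite nuE// -integral_cst//.
apply: le_integral => //; [exact: finite_measure_integrable_cst|exact: iphi|].
by move=> x /set_mem /cE; rewrite lee_fin.
Qed.

Let nu_le (c : R) E : measurable E -> (forall x : borel S, E x -> phi x <= c) ->
  (nu E <= c%:E * m E)%E.
Proof.
move=> mE cE; rewrite nuE// -integral_cst//.
apply: le_integral => //; [exact: iphi|exact: finite_measure_integrable_cst|].
by move=> x /set_mem /cE; rewrite lee_fin.
Qed.

(** With E = {phi > t} and F = sigma^-1 E, invariance of [m] and [nu = phi m]
    gives the same mass to E \ F and F \ E.  As phi > t on the former and
    phi <= t on the latter, nu (E \ F) = t m (E \ F).  If phi x > phi (sigma x),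
    a cylinder around [x] on which [phi] exceeds [t] by a definite amount
    contradicts this. *)
Let phi_shift x : phi x <= phi (sh x).
Proof.
rewrite leNgt; apply/negP => xx.
(* margins: phi >= t + e around x, and phi <= t around sigma x *)
pose e := (phi x - phi (sh x)) / 4; pose t := (phi x + phi (sh x)) / 2.
have e0 : 0 < e by rewrite divr_gt0// subr_gt0.
pose E := [set y : borel S | t < phi y]; pose F := sh @^-1` E.
have mE : measurable E by exact: measurable_gt.
have mF : measurable F by rewrite -[F]setTI; exact: measurable_shift.
have [k kx] := phi_near x e0; have [l lx] := phi_near (sh x) e0.
pose C := cyl x (maxn k l).+1 : set (borel S).
have mC : measurable C by exact: measurable_cyl.
have Cphi y : C y -> t + e <= phi y /\ phi (sh y) <= t.
  move=> Cy; have /kx : cyl x k y.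
    by move=> i ik; apply: Cy; rewrite (leq_trans ik)// leqW// leq_maxl.
  have /lx : cyl (sh x) l (sh y).
    by move=> i ik; apply: Cy; rewrite ltnS (leq_trans ik)// leq_maxr.
  by rewrite !ltr_norml /e /t; lra.
have CEF : C `<=` E `\` F.
  move=> y /Cphi[ty yt]; split; first by rewrite /E /=; lra.
  by rewrite /F /E /=; lra.
have fin (mu : probability (borel S) R) B : measurable B -> mu B \is a fin_num.
  by move=> mB; exact: fin_num_measure.
have EF_FE (mu : probability (borel S) R) : mu F = mu E -> mu (E `\` F) = mu (F `\` E).
  move=> FE; have lty B : measurable B -> (mu B < +oo)%E by move=> mB; rewrite ltey_eq fin.
  rewrite (measureD mE mF (lty _ mE)) (measureD mF mE (lty _ mF)) setIC.
  by congr (_ - _)%E; exact/esym.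
have mEF : measurable (E `\` F) by exact: measurableD.
have mFE : measurable (F `\` E) by exact: measurableD.
have mEC : measurable ((E `\` F) `\` C) by exact: measurableD.
have split_C (mu : probability (borel S) R) :
    mu (E `\` F) = (mu C + mu ((E `\` F) `\` C))%E.
  rewrite -measureU//; last by rewrite setDE setICA setICr setI0.
  by rewrite setDE setUIr setUCr setIT; congr (mu _); apply/esym/setUidPr.
have nuC : ((t + e)%:E * m C <= nu C)%E by apply: nu_ge => // y /Cphi[].
have nuEC : (t%:E * m ((E `\` F) `\` C) <= nu ((E `\` F) `\` C))%E.
  by apply: nu_ge => // y [[/ltW]].
have nuFE : (nu (F `\` E) <= t%:E * m (F `\` E))%E.
  by apply: nu_le => // y [_ /negP]; rewrite -leNgt.
move: nuFE; rewrite -!EF_FE; [|exact: m_inv|exact: nu_inv].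
rewrite !split_C; move: (cyl_gt0 x (maxn k l).+1) nuC nuEC; rewrite -/C.
rewrite -(fineK (fin m C mC)) -(fineK (fin nu C mC)).
rewrite -(fineK (fin m _ mEC)) -(fineK (fin nu _ mEC)).
rewrite -!EFinD -!EFinM !lee_fin lte_fin.
move: (fine (m C)) (fine (nu C)) (fine (m ((E `\` F) `\` C))) (fine (nu ((E `\` F) `\` C))).
move=> a b c d a0 ab cd bd.
have : e * a <= 0 by nra.
by rewrite leNgt mulr_gt0.
Qed.

(** [phi] is at most [phi y] on all the points obtained from [y] by prepending
    symbols, and these are dense. *)
Let phi_le x y : phi x <= phi y.
Proof.
rewrite leNgt; apply/negP => yx.
have [|k kx] := @phi_near x (phi x - phi y); first by rewrite subr_gt0.
have [||z /kx xz zy] := @backward_dense _ _ _ _ (fun z => phi z <= phi y) y _ _ x k.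
- exact: lexx.
- move=> i z iz; apply: le_trans; rewrite -{2}(shift_prepend iz); exact: phi_shift.
- by move: xz; rewrite ltr_norml => /andP[_]; lra.
Qed.

Lemma invariant_lipschitz_density : forall E, measurable E -> nu E = m E.
Proof.
have phiE x : phi x = phi point by apply/le_anti; rewrite !phi_le.
have nuc E : measurable E -> nu E = ((phi point)%:E * m E)%E.
  move=> mE; rewrite nuE//; under eq_integral do rewrite phiE.
  by rewrite integral_cst.
move=> E mE; rewrite nuc//.
have := nuc _ measurableT; rewrite !probability_setT mule1 => <-.
by rewrite mul1e.
Qed.

End density_rigidity.

(** * Coding a finite distribution by a uniform variable *)

Section uniform01.
Context (R : realType).
Local Notation leb := (@lebesgue_measure R).

Let m01 : measurable (`]0, 1] : set (measurableTypeR R)).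
Proof. exact: measurable_itv. Qed.

Definition unif01 : set (measurableTypeR R) -> \bar R := mrestr leb m01.

HB.instance Definition _ := Measure.on unif01.

Let unif01_setT : unif01 setT = 1%E.
Proof. by rewrite /unif01 /mrestr setTI lebesgue_measure_itv /= lte01 sube0. Qed.

HB.instance Definition _ := Measure_isProbability.Build _ _ _ unif01 unif01_setT.

(** Uniqueness of the Lebesgue measure, tested on half-open intervals. *)
Lemma lebesgue_affine (s q : R) (B : set (measurableTypeR R)) : 0 < q ->
  measurable B -> leb [set u | B ((u - s) / q)] = (q%:E * leb B)%E.
Proof.
move=> q0 mB.
pose f (u : measurableTypeR R) : measurableTypeR R := (u - s) / q.
have mf : measurable_fun setT f.
  apply: measurable_funM => //; exact: measurable_funB.
have qV0 : 0 <= q^-1 by rewrite invr_ge0 ltW.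
pose mu := mscale (NngNum qV0) (image_measure mf leb).
have muE X : measurable X -> leb X = mu X.
  apply: lebesgue_measure_unique => _ [[a b] /= ab <-].
  rewrite /mu /mscale /= /pushforward.
  have -> : f @^-1` `]a, b]%classic = `]a * q + s, b * q + s]%classic.
    apply/seteqP; split => u /=; rewrite !in_itv /= /f.
      by rewrite ltr_pdivlMr// ler_pdivrMr// ltrBrDr lerBlDr.
    by rewrite ltr_pdivlMr// ler_pdivrMr// ltrBrDr lerBlDr.
  rewrite !lebesgue_measure_itv /= !lte_fin ltrD2r ltr_pM2r//.
  case: ifPn => _; last by rewrite mule0.
  rewrite -!EFinD -EFinM; congr (_%:E); field.
  by rewrite gt_eqF.
rewrite (muE B mB) /mu /mscale /= muleA -EFinM divff ?gt_eqF// mul1e.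
by [].
Qed.

Variables (n : nat) (w : 'I_n.+1 -> R).
Hypothesis w_ge0 : forall i, 0 <= w i.
Hypothesis w_sum1 : \sum_i w i = 1.

Definition cum (k : nat) : R := \sum_(i < n.+1 | (i < k)%N) w i.

(** The cells partition ]0, 1] into intervals of lengths [w i]. *)
Definition cell (i : 'I_n.+1) : set (measurableTypeR R) := `]cum i, cum i.+1].

Lemma cumS (i : 'I_n.+1) : cum i.+1 = cum i + w i.
Proof.
rewrite /cum (bigD1 i)//= addrC; congr (_ + _); apply: eq_bigl => j.
by rewrite ltnS [RHS]ltn_neqAle andbC.
Qed.

Lemma cum_le k l : (k <= l)%N -> cum k <= cum l.
Proof.
move=> kl; rewrite /cum [leRHS](bigID (fun i : 'I_n.+1 => (i < k)%N)) /=.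
rewrite [X in _ <= X + _](_ : _ = cum k); first by rewrite lerDl sumr_ge0.
apply: eq_bigl => i; case: (ltnP i k) => ik; rewrite ?andbF// andbT.
by rewrite (leq_trans ik).
Qed.

Lemma cum0 : cum 0 = 0.
Proof. by rewrite /cum big1. Qed.

Lemma cum_max : cum n.+1 = 1.
Proof. by rewrite /cum -w_sum1; apply: eq_bigl => i; rewrite ltn_ord. Qed.

Lemma cell_sub01 i : cell i `<=` `]0, 1].
Proof.
move=> u; rewrite /cell /= !in_itv /= => /andP[iu ui].
rewrite (le_lt_trans _ iu) -?cum0 ?cum_le//=.
by rewrite (le_trans ui)// -cum_max cum_le.
Qed.

Lemma cell_inj u i j : cell i u -> cell j u -> i = j.
Proof.
wlog ij : i j / (i <= j)%N => [H iu ju|].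
  have [ij|/ltnW ij] := leqP i j; first exact: H.
  by apply/esym; exact: H.
rewrite /cell /= !in_itv /= => /andP[_ ui] /andP[ju _]; apply/val_inj/eqP => /=.
rewrite eqn_leq ij leqNgt /=; apply/negP => /cum_le.
by rewrite leNgt (lt_le_trans ju ui).
Qed.

Lemma cell_ex u : 0 < u <= 1 -> exists i, cell i u.
Proof.
move=> /andP[u0 u1].
have H k : (k <= n.+1)%N -> u <= cum k -> exists i, cell i u.
  elim: k => [_|k IH kn ui]; first by rewrite cum0 leNgt u0.
  have [/(IH (ltnW kn))//|ku] := leP u (cum k).
  by exists (Ordinal kn); rewrite /cell /= in_itv /= ku ui.
by apply: (H n.+1) => //; rewrite cum_max.
Qed.

Lemma measurable_cell i : measurable (cell i).
Proof. exact: measurable_itv. Qed.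

Lemma cell_gt0 i u : cell i u -> 0 < w i.
Proof.
rewrite /cell /= in_itv /= cumS => /andP[a b].
by rewrite -(ltrDl (cum i)); exact: lt_le_trans a b.
Qed.

Definition rescale (i : 'I_n.+1) (u : R) : R := (u - cum i) / w i.

(** A uniform variable conditioned to be in a cell is uniform once rescaled. *)
Lemma unif01_cell i (B : set (measurableTypeR R)) : measurable B ->
  unif01 (cell i `&` [set u | B (rescale i u)]) = ((w i)%:E * unif01 B)%E.
Proof.
move=> mB; have := w_ge0 i; rewrite le_eqVlt => /predU1P[wi0|wi0].
  rewrite -wi0 mul0e; have -> : cell i = set0; last by rewrite set0I measure0.
  by apply/seteqP; split => // u /cell_gt0; rewrite -wi0 ltxx.
rewrite /unif01 /mrestr -(lebesgue_affine (cum i) wi0); last exact: measurableI.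
congr (leb _); apply/seteqP; split => u /=; rewrite /rescale.
  move=> [[iu Bu] _]; split => //; move: iu; rewrite /cell /= !in_itv /= cumS.
  move=> /andP[a b]; rewrite divr_gt0 ?subr_gt0//=.
  by rewrite ler_pdivrMr// mul1r lerBlDl.
move=> [Bu]; rewrite in_itv /= => /andP[].
rewrite pmulr_lgt0 ?invr_gt0// subr_gt0 ler_pdivrMr// mul1r lerBlDl -cumS => a b.
have iu : cell i u by rewrite /cell /= in_itv /= a b.
by split => //; exact: cell_sub01 iu.
Qed.

End uniform01.

(** * Random backward trajectories of the Markov measure *)

Lemma fst_setX (T1 T2 : Type) (B : set T1) (C : set T2) :
  fst @^-1` B `&` setT `*` C = B `*` C.
Proof. by apply/seteqP; split => -[x u] /=; tauto. Qed.

Section backward_steps.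
Context (R : realType) (theta : {itv R & `]0, 1[}) (n : nat)
  (A : aperiodicMx n).
Local Notation S := (borel (sft theta A)).
Local Notation I := 'I_n.+1.
Local Notation U := (measurableTypeR R).
Context (m : probability S R) (P : 'M[R]_n.+1) (p : 'rV[R]_n.+1).
Hypothesis P_gt0 : forall i j, 0 < P i j <-> A i j = 1%N.
Hypothesis P_ge0 : forall i j, 0 <= P i j.
Hypothesis p_gt0 : forall i, 0 < p 0 i.
Hypothesis pP : p *m P = p.
Hypothesis m_cyl : forall (a : nat -> I) (k : nat),
  m (cyl a k) = (p 0 (a 0%N) * \prod_(i < k) P (a i) (a i.+1))%:E.

(** Transition probabilities of the time reversal of the chain. *)
Definition backward j i : R := p 0 i * P i j / p 0 j.

Lemma backward_ge0 j i : 0 <= backward j i.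
Proof. by rewrite divr_ge0 ?mulr_ge0// ltW. Qed.

Lemma backward_sum1 j : \sum_i backward j i = 1.
Proof.
rewrite -big_distrl /=; have -> : \sum_i p 0 i * P i j = p 0 j.
  by rewrite -[in RHS]pP mxE.
by rewrite divff// gt_eqF.
Qed.

Lemma backward_gt0 j i : 0 < backward j i -> A i j = 1%N.
Proof.
rewrite pmulr_lgt0 ?invr_gt0// pmulr_rgt0// => h; exact/P_gt0.
Qed.

Lemma backward_adm j : exists i, A i j == 1%N.
Proof.
apply: contrapT => /forallNP Aj.
have := backward_sum1 j; rewrite big1 => [/eqP|i _]; first by rewrite eq_sym oner_eq0.
apply/eqP; move: (backward_ge0 j i); rewrite le_eqVlt => /predU1P[<-//|].
by move=> /backward_gt0 /eqP /Aj.
Qed.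

(** The default value matters only for [u] outside ]0, 1], a null set; taking
    it admissible makes [shift_backward_step] true everywhere. *)
Definition pick_pred j (u : U) : I :=
  odflt (xchoose (backward_adm j)) [pick i | u \in cell (backward j) i].

Lemma pick_pred_adm j u : A (pick_pred j u) j = 1%N.
Proof.
rewrite /pick_pred; case: pickP => [i /set_mem /cell_gt0 /backward_gt0//|_] /=.
exact/eqP/(xchooseP (backward_adm j)).
Qed.

Lemma pick_pred_cell j i u : 0 < u <= 1 ->
  (pick_pred j u = i) <-> cell (backward j) i u.
Proof.
move=> u01; have [k ku] := cell_ex (backward_sum1 j) u01.
have -> : pick_pred j u = k.
  rewrite /pick_pred; case: pickP => [l /set_mem lu|/(_ k)] /=.
    exact: (@cell_inj R n (backward j) (backward_ge0 j) u l k lu ku).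
  by rewrite mem_set.
by split => [<-//|iu]; exact: (@cell_inj R n (backward j) (backward_ge0 j) u k i ku iu).
Qed.

Lemma measurable_pick_pred j i : measurable [set u | pick_pred j u = i].
Proof.
have m01 : measurable (`]0, 1] : set U) by exact: measurable_itv.
pose D := if xchoose (backward_adm j) == i then ~` (`]0, 1]%classic : set U) else set0.
have -> : [set u | pick_pred j u = i] = cell (backward j) i `|` D.
  apply/seteqP; split => u /=.
    have [u01 ui|u01] := boolP (0 < u <= 1); first by left; apply/pick_pred_cell.
    rewrite /pick_pred; case: pickP => [l /set_mem lu|_] /=.
      by move=> <-; left.
    by move=> iE; right; rewrite /D iE eqxx /= in_itv /=; exact/negP.
  move=> [iu|].
    apply/pick_pred_cell => //.
    by have := cell_sub01 (backward_ge0 j) (backward_sum1 j) iu; rewrite /= in_itv.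
  rewrite /D; case: eqP => // iE; rewrite /= in_itv /= => u01; rewrite -iE.
  rewrite /pick_pred; case: pickP => [l /set_mem lu|//].
  have := cell_sub01 (backward_ge0 j) (backward_sum1 j) lu.
  by rewrite /= in_itv.
apply: measurableU; first exact: measurable_cell.
by rewrite /D; case: eqP => _ //; exact: measurableC.
Qed.

(** The base component of the first step is [x] with a random symbol prepended;
    the second component is a fresh uniform variable for the next step. *)
Definition backward_step (w : S * U) : S * U :=
  let i := pick_pred (w.1 0%N) w.2 in
  (prepend i w.1, rescale (backward (w.1 0%N)) i w.2).

Local Notation Th := backward_step.

Lemma shift_backward_step (w : S * U) : sft_shift (Th w).1 = w.1.
Proof. by apply: shift_prepend; exact: pick_pred_adm. Qed.

Let tailcyl (a : nat -> I) k : set S := cyl (fun i => a i.+1) k.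

(** Once [a 1] is the first symbol of the base point, prepending [a 0] is an
    event on the uniform variable alone, so the preimage is a rectangle. *)
Lemma backward_step_cyl a k : [set w | cyl a k.+1 (Th w).1] =
  tailcyl a k `*` [set u | pick_pred (a 1%N) u = a 0%N].
Proof.
apply/seteqP; split => -[x u] /=.
  move=> c; have xa : tailcyl a k x.
    move=> i ik; rewrite -(c i.+1)//= prependS//; exact: pick_pred_adm.
  split => //; rewrite -(c 0%N)//= prepend0; last exact: pick_pred_adm.
  by rewrite xa.
move=> [xa ua]; have x0 : x 0%N = a 1%N by rewrite xa.
case=> [|i] ik /=; first by rewrite prepend0 ?x0//; exact: pick_pred_adm.
by rewrite prependS ?xa//; exact: pick_pred_adm.
Qed.

Lemma measurable_rescale (w : I -> R) i : measurable_fun [set: U] (rescale w i : U -> U).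
Proof. by apply: measurable_funM => //; exact: measurable_funB. Qed.

Lemma measurable_head j : measurable [set x : S | x 0%N = j].
Proof.
have -> : [set x : S | x 0%N = j] = cyl (fun=> j) 0; last exact: measurable_cyl.
apply/seteqP; split => x /=; last exact.
by move=> x0 i; rewrite leqn0 => /eqP ->.
Qed.

Lemma measurable_backward_step : measurable_fun setT Th.
Proof.
apply/measurable_fun_pairP; split.
  apply: (measurability _ (@borel_sft R theta n A)).
  move=> _ [_ [->|[a [k ->]]] <-]; first by rewrite preimage_set0 setI0.
  rewrite setTI [X in measurable X]backward_step_cyl; apply: measurableX.
    exact: measurable_cyl.
  exact: measurable_pick_pred.
move=> _ B mB; rewrite setTI.
have -> : (snd \o Th) @^-1` B = \big[setU/set0]_(j : I) \big[setU/set0]_(i : I)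
    ([set x : S | x 0%N = j] `*` ([set u | pick_pred j u = i] `&`
      rescale (backward j) i @^-1` B)).
  apply/seteqP; split => -[x u] /=.
    move=> Bxu; rewrite -bigcup_seq; exists (x 0%N); first by rewrite /= mem_index_enum.
    rewrite -bigcup_seq; exists (pick_pred (x 0%N) u); first by rewrite /= mem_index_enum.
    by [].
  rewrite -bigcup_seq => -[j _]; rewrite -bigcup_seq => -[i _] [/= -> [/= -> ]].
  by [].
apply: bigsetU_measurable => j _; apply: bigsetU_measurable => i _.
apply: measurableX; first exact: measurable_head.
apply: measurableI; first exact: measurable_pick_pred.
by rewrite -[X in measurable X]setTI; exact: measurable_rescale.
Qed.

(** For fixed [C], both sides are measures of the first factor [B] of a
    rectangle [B `*` C], so it suffices to take for [B] a cylinder.  The preimage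
    is then a rectangle, and the equality is the definition of [backward]. *)
Lemma backward_step_preserves E : measurable E ->
  (m \x @unif01 R)%E (Th @^-1` E) = (m \x @unif01 R)%E E.
Proof.
move=> mE; apply/esym.
apply: (product_measure_unique
  (m' := image_measure measurable_backward_step (m \x @unif01 R)%E)) => // B C mB mC.
have mThC : measurable ((snd \o Th) @^-1` C).
  have /measurable_fun_pairP[_ h] := measurable_backward_step.
  by rewrite -[X in measurable X]setTI; exact: h.
have mTC : measurable (setT `*` C : set (S * U)) by exact: measurableX.
have mTh1 : measurable_fun setT (fst \o Th).
  by have /measurable_fun_pairP[] := measurable_backward_step.
have /= := @cyl_measure_unique R theta n A
  (image_measure mTh1 (mrestr (m \x @unif01 R)%E mThC))
  (image_measure measurable_fst (mrestr (m \x @unif01 R)%E mTC)) _ _ B mB.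
rewrite /= /pushforward /mrestr => H.
transitivity ((m \x @unif01 R)%E ((fst \o Th) @^-1` B `&` (snd \o Th) @^-1` C)).
  by congr (_ _); apply/seteqP; split.
rewrite H; last first.
- move=> a k.
  have -> : (fst \o Th) @^-1` cyl a k.+1 `&` (snd \o Th) @^-1` C =
    tailcyl a k `*` ([set u | pick_pred (a 1%N) u = a 0%N] `&`
      rescale (backward (a 1%N)) (a 0%N) @^-1` C).
    rewrite [X in X `&` _](_ : _ = [set w | cyl a k.+1 (Th w).1])// backward_step_cyl.
    apply/seteqP; split => -[x u] /=.
      by move=> [[xa ua] Cu]; split => //; split => //; move: Cu; rewrite xa// ua.
    by move=> [xa [ua Cu]]; split => //; rewrite xa// ua.
  rewrite fst_setX.
  have mt : measurable (tailcyl a k) by exact: measurable_cyl.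
  have mc : measurable (cyl a k.+1 : set S) by exact: measurable_cyl.
  have mp : measurable ([set u | pick_pred (a 1%N) u = a 0%N] `&`
      rescale (backward (a 1%N)) (a 0%N) @^-1` C).
    apply: measurableI; first exact: measurable_pick_pred.
    by rewrite -[X in measurable X]setTI; exact: measurable_rescale.
  rewrite !product_measure1E//.
  have uE : @unif01 R ([set u | pick_pred (a 1%N) u = a 0%N] `&`
      rescale (backward (a 1%N)) (a 0%N) @^-1` C) =
      @unif01 R (cell (backward (a 1%N)) (a 0%N) `&`
      [set u | C (rescale (backward (a 1%N)) (a 0%N) u)]).
    rewrite /unif01 /mrestr; congr (lebesgue_measure _).
    apply/seteqP; split => u /=; rewrite in_itv /=.
      by move=> [[ua Cu] u01]; split => //; split => //; apply/pick_pred_cell.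
    by move=> [[ua Cu] u01]; split => //; split => //; apply/pick_pred_cell.
  rewrite [X in (_ * X = _)%E]uE unif01_cell//;
    [|exact: backward_ge0|exact: backward_sum1].
  rewrite [X in (X * _ = _)%E](m_cyl (fun i => a i.+1) k) [X in (_ = X * _)%E]m_cyl.
  rewrite muleA -EFinM; congr (_%:E * _)%E.
  rewrite big_ord_recl /= /backward; set q := \prod_(i < k) _.
  by field; rewrite gt_eqF.
- apply: le_lt_trans (ltry 1).
  apply: (@probability_le1 _ _ _ (m \x @unif01 R)%E).
  by rewrite preimage_setT setTI.
by rewrite fst_setX product_measure1E.
Qed.

End backward_steps.

(** A measure preserving random inverse branch [Th] of [sh] witnesses the
    invariance of the base measure. *)
Lemma section_shift_invariant (R : realType) d (X : measurableType d) d'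
    (V : measurableType d') (m : probability X R) (lam : probability V R)
    (sh : X -> X) (Th : X * V -> X * V) :
  measurable_fun setT sh -> 
  (forall w, sh (Th w).1 = w.1) ->
  (forall E, measurable E -> (m \x lam)%E (Th @^-1` E) = (m \x lam)%E E) ->
  forall E, measurable E -> m (sh @^-1` E) = m E.
Proof.
move=> msh shTh pTh E mE.
have mshE : measurable (sh @^-1` E) by rewrite -[X in measurable X]setTI; exact: msh.
have prodE B : measurable B -> (m \x lam)%E (B `*` setT) = m B.
  move=> mB; rewrite product_measure1E// -[RHS]mule1; congr (_ * _)%E.
  exact: probability_setT.
rewrite -prodE// -pTh; last exact: measurableX.
rewrite -[RHS]prodE//; congr ((_ \x _)%E _).
by apply/seteqP; split => w /=; rewrite shTh.
Qed.


(** * Skew products contracting every fibre *)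

Section fibre_contraction.
Context (R : realType) d (X : measurableType d) (sh : X -> X).
Hypothesis msh : measurable_fun setT sh.
Context (K : pmetricType R) (K_compact : compact [set: K]).
Hypothesis K_le1 : forall y z : K, mdist y z <= 1.
Context (G : X * borel K -> borel K) (mG : measurable_fun setT G).
Context (alpha : R) (alpha01 : 0 < alpha < 1).
Hypothesis G_contr : forall x (y z : K),
  mdist (G (x, y) : K) (G (x, z)) <= alpha * mdist y z.
Let F (z : X * borel K) : X * borel K := (sh z.1, G z).

Let alpha_gt0 : 0 < alpha. Proof. by case/andP: alpha01. Qed.

Let mF : measurable_fun setT F.
Proof.
apply/measurable_fun_pairP; split; last exact: mG.
exact: measurableT_comp msh measurable_fst.
Qed.

Section invariant_section.
Context d' (V : measurableType d') (Th : X * V -> X * V).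
Hypothesis mTh : measurable_fun setT Th.

Fixpoint fibre_iter (k : nat) (w : X * V) : borel K :=
  if k is k'.+1 then G ((Th w).1, fibre_iter k' (Th w)) else point.

(** The fixed point of a contraction on the maps from [X * V] to [K], reached by
    iteration from a constant map so that measurability follows. *)
Lemma invariant_section : exists2 Y : X * V -> borel K,
  measurable_fun setT Y & forall w, Y w = G ((Th w).1, Y (Th w)).
Proof.
have step k w : mdist (fibre_iter k w : K) (fibre_iter k.+1 w) <= alpha ^+ k.
  elim: k w => [|k IH] w; first by rewrite expr0 K_le1.
  by apply: le_trans (G_contr _ _ _) _; rewrite exprS ler_wpM2l ?(ltW alpha_gt0)// IH.
have cvY w : cvgn (fibre_iter ^~ w : nat -> K).
  exact: geometric_cvg K_compact alpha01 (step^~ w).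
pose Y w : borel K := lim ((fibre_iter ^~ w : nat -> K) @ \oo).
have dY w : (fun k => mdist (fibre_iter k w : K) (Y w)) @ \oo --> (0 : R).
  apply/cvgrPdist_lt => e e0.
  have /metricType_numDomainType.cvgrPdist_lt /(_ e e0) := cvY w.
  apply: filterS => k; rewrite sub0r normrN metric_sym => h.
  by rewrite ger0_norm ?mdist_ge0.
exists Y.
  apply: (measurable_limit _ dY); elim=> [|k IH]; first exact: measurable_cst.
  apply: measurableT_comp mG _; apply/measurable_fun_pairP; split.
    exact: measurableT_comp measurable_fst mTh.
  exact: measurableT_comp IH mTh.
move=> w; apply: (@mdist_positivity _ K).
apply/eqP; rewrite eq_le mdist_ge0 andbT.
have h : (fun k => mdist (fibre_iter k.+1 w : K) (Y w) +
    alpha * mdist (fibre_iter k (Th w) : K) (Y (Th w))) @ \oo --> (0 : R).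
  rewrite -[X in _ --> X](addr0 0); apply: cvgD.
    by have := dY w; rewrite -cvg_shiftS.
  by rewrite -[X in _ --> X](mulr0 alpha); apply: cvgMr; exact: dY.
rewrite -(cvg_lim (@Rhausdorff R) h); apply: limr_ge; first by apply/cvg_ex; eexists; exact: h.
apply: nearW => k.
apply: le_trans (metric_triangle _ (fibre_iter k.+1 w : K) _) _.
by rewrite [mdist (Y w) _]metric_sym lerD2l; exact: G_contr.
Qed.

End invariant_section.

Section graph_measure.
Context (m : probability X R) d' (V : measurableType d') (lam : probability V R).
Context (Y : X * V -> borel K) (mY : measurable_fun setT Y).

Let mgraph : measurable_fun setT (fun w => (w.1, Y w)).
Proof. by apply/measurable_fun_pairP; split => //; exact: measurable_fst. Qed.

Definition graph_measure : probability (X * borel K)%type R :=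
  image_prob mgraph (m \x lam)%E.

Let msection x : measurable_fun setT (fun v => (x, Y (x, v))).
Proof.
apply/measurable_fun_pairP; split; first exact: measurable_cst.
exact: measurable_fun_pair2.
Qed.

Definition graph_kernel x : probability (X * borel K)%type R :=
  image_prob (msection x) lam.

Lemma graph_measure_int E : graph_measure E = (\int[m]_x graph_kernel x E)%E.
Proof.
rewrite /= /distribution /pushforward /= /product_measure1.
by apply: eq_integral => x _ /=; rewrite xsectionE.
Qed.

Lemma measurable_graph_kernel E : measurable E ->
  measurable_fun setT (fun x => graph_kernel x E).
Proof.
move=> mE.
have := @measurable_fun_xsection _ _ X V R lam ((fun w => (w.1, Y w)) @^-1` E).
rewrite -[X in measurable X]setTI => /(_ (mgraph measurableT mE)).
apply: eq_measurable_fun => x _ /=; rewrite /distribution /pushforward /=.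
by rewrite xsectionE.
Qed.

Lemma graph_kernel_leaf x : graph_kernel x ([set x] `*` setT) = 1%E.
Proof.
rewrite /= /distribution /pushforward /=.
by rewrite (_ : _ @^-1` _ = setT) ?probability_setT//; apply/seteqP; split.
Qed.

Lemma graph_measure_fst C : measurable C -> graph_measure (fst @^-1` C) = m C.
Proof.
move=> mC; rewrite /= /distribution /pushforward /=.
have -> : (fun w : X * V => (w.1, Y w)) @^-1` (fst @^-1` C) = C `*` setT.
  by apply/seteqP; split => -[x v] //= [].
rewrite product_measure1E// -[RHS]mule1; congr (_ * _)%E.
exact: probability_setT.
Qed.

(** Invariance of the base under [Th] lets one replace [w] by [Th w], and the
    skew product maps the graph over [Th w] to the graph over [w]. *)
Lemma graph_measure_invariant (Th : X * V -> X * V) :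
  measurable_fun setT Th ->
  (forall w, sh (Th w).1 = w.1) ->
  (forall E, measurable E -> (m \x lam)%E (Th @^-1` E) = (m \x lam)%E E) ->
  (forall w, Y w = G ((Th w).1, Y (Th w))) ->
  forall E, measurable E -> graph_measure (F @^-1` E) = graph_measure E.
Proof.
move=> mTh shTh pTh YTh E mE.
rewrite /= /distribution /pushforward /= -[LHS]pTh; last first.
  rewrite -[X in measurable X]setTI; apply: mgraph => //.
  by rewrite -[X in measurable X]setTI; exact: mF.
congr ((_ \x _)%E _); apply/seteqP; split => w /=.
  by rewrite /F /= shTh -YTh.
by rewrite /F /= shTh -YTh.
Qed.

End graph_measure.

Section uniqueness.
Variables (mu nu : probability (X * borel K)%type R).
Hypothesis mu_inv : forall E, measurable E -> mu (F @^-1` E) = mu E.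
Hypothesis nu_inv : forall E, measurable E -> nu (F @^-1` E) = nu E.
Hypothesis mu_nu_fst : forall C, measurable C -> mu (fst @^-1` C) = nu (fst @^-1` C).

Let miter k : measurable_fun setT (iter k F).
Proof. by elim: k => [|k IH]; [exact: measurable_id|exact: measurableT_comp mF IH]. Qed.

Let iter_inv (rho : probability (X * borel K)%type R) :
  (forall E, measurable E -> rho (F @^-1` E) = rho E) ->
  forall k E, measurable E -> rho (iter k F @^-1` E) = rho E.
Proof.
move=> rinv; elim=> [//|k IH] E mE.
have mFE : measurable (F @^-1` E) by rewrite -[X in measurable X]setTI; exact: mF.
by rewrite -[RHS]rinv// -[RHS]IH.
Qed.

Let iter_fst k x y z : (iter k F (x, y)).1 = (iter k F (x, z)).1.
Proof. by elim: k => //= k ->. Qed.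

Let iter_contr k x (y z : K) :
  mdist ((iter k F (x, y)).2 : K) (iter k F (x, z)).2 <= alpha ^+ k.
Proof.
elim: k => [|k IH]; first by rewrite expr0 K_le1.
rewrite /= (surjective_pairing (iter k F (x, y))).
rewrite (surjective_pairing (iter k F (x, z))) (iter_fst k x y z).
apply: le_trans (G_contr _ _ _) _.
by rewrite exprS ler_wpM2l ?(ltW alpha_gt0).
Qed.

(** For [alpha ^+ k < e], whether the k-th iterate is well inside [U] is decided,
    up to an error [e] in the gap, by the base point: compare with the iterate
    of [(x, point)] on the same leaf. *)
Lemma invariant_le (C : set X) (U : set K) (e : R) : measurable C -> open U -> 0 < e ->
  (nu (C `*` [set y | (2 * e < gap U y)%R]) <= mu (C `*` U))%E.
Proof.
move=> mC oU e0.
have mU : measurable (U : set (borel K)) by exact: sub_sigma_algebra.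
have [k ke] : exists k, alpha ^+ k < e.
  have h : (fun k => alpha ^+ k) @ \oo --> (0 : R).
    by apply: cvg_expr; rewrite ger0_norm ?ltW//; case/andP: alpha01.
  have /cvgrPdist_lt /(_ _ e0) [k _ /(_ k (leqnn _))] := h.
  by rewrite /= sub0r normrN => ak; exists k; apply: le_lt_trans ak; exact: ler_norm.
pose D := [set x : X | C (iter k F (x, point)).1 /\
  e < gap U (iter k F (x, point)).2].
have mD : measurable D.
  have -> : D = (fun x => iter k F (x, point)) @^-1` (C `*` [set y | e < gap U y]) by [].
  rewrite -[X in measurable X]setTI.
  have mp : measurable_fun setT (fun x : X => iter k F (x, point : borel K)).
    apply: measurableT_comp (miter k) _; exact: pair2_measurable.
  by apply: mp => //; apply: measurableX => //; exact: measurable_gap_gt.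
have mfD : measurable (fst @^-1` D : set (X * borel K)).
  by rewrite -[X in measurable X]setTI; exact: measurable_fst.
have mCU : measurable (C `*` U : set (X * borel K)) by exact: measurableX.
have mCe : measurable (C `*` [set y | 2 * e < gap U y] : set (X * borel K)).
  by apply: measurableX => //; exact: measurable_gap_gt.
have mpre E : measurable E -> measurable (iter k F @^-1` E).
  by move=> mE; rewrite -[X in measurable X]setTI; exact: miter.
rewrite -(iter_inv nu_inv k mCe) -(iter_inv mu_inv k mCU).
apply: (@le_trans _ _ (nu (fst @^-1` D))).
  apply: le_measure; rewrite ?inE//; first exact: mpre.
  move=> [x y] /= [Cx gx]; split => /=; first by rewrite (iter_fst _ _ _ y).
  have := gap_lip U (iter k F (x, y)).2 (iter k F (x, point)).2.
  have := iter_contr k x y point; rewrite ler_norml => a /andP[_ b]; lra.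
rewrite -mu_nu_fst//; apply: le_measure; rewrite ?inE//; first exact: mpre.
move=> [x y] /= [Cx gx]; split => /=; first by rewrite (iter_fst _ _ _ point).
apply/(gap_gt0 _ oU).
have := gap_lip U (iter k F (x, point)).2 (iter k F (x, y)).2.
have := iter_contr k x point y; rewrite ler_norml => a /andP[_ b]; lra.
Qed.

End uniqueness.

(** An open set is the increasing union of the sets where its gap exceeds a
    positive bound. *)
Lemma invariant_le_open (mu nu : probability (X * borel K)%type R) C U :
  (forall E, measurable E -> mu (F @^-1` E) = mu E) ->
  (forall E, measurable E -> nu (F @^-1` E) = nu E) ->
  (forall C, measurable C -> mu (fst @^-1` C) = nu (fst @^-1` C)) ->
  measurable C -> open U -> (nu (C `*` U) <= mu (C `*` U))%E.
Proof.
move=> mui nui mn mC oU.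
pose W k : set (X * borel K) := C `*` [set y | (2 * k.+1%:R^-1 < gap U y)%R].
have mW k : measurable (W k) by apply: measurableX => //; exact: measurable_gap_gt.
have WU : \bigcup_k W k = C `*` U.
  apply/seteqP; split => [[x y] [k _ [Cx gy]]|[x y] [/= Cx /(gap_gt0 _ oU) gy]].
    split => //=; apply/(gap_gt0 _ oU); apply: le_lt_trans gy.
    by rewrite mulr_ge0// invr_ge0.
  have [k ky] : exists k, k.+1%:R^-1 < gap U y / 2.
    have g2 : 0 < gap U y / 2 by rewrite divr_gt0.
    exists (Num.truncn ((gap U y / 2)^-1)).
    by rewrite -[X in _ < X]invrK ltf_pV2 ?posrE ?invr_gt0// truncnS_gt// invr_ge0 ltW.
  by exists k => //; split => //=; rewrite mulrC -ltr_pdivlMr.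
have : nu (W k) @[k --> \oo] --> nu (C `*` U).
  rewrite -WU; apply: nondecreasing_cvg_mu => //.
    by rewrite WU; apply: measurableX => //; exact: sub_sigma_algebra.
  move=> k l kl; apply/subsetPset => -[x y] [Cx /= gy]; split => //=.
  apply: le_lt_trans gy; rewrite ler_pM2l// lef_pV2 ?posrE ?ltr0n//.
  by rewrite ler_nat ltnS.
move=> /cvg_lim <- //; apply: lime_le.
  apply: ereal_nondecreasing_is_cvgn => k l kl; apply: le_measure; rewrite ?inE//.
  move=> -[x y] [Cx /= gy]; split => //=.
  apply: le_lt_trans gy; rewrite ler_pM2l// lef_pV2 ?posrE ?ltr0n//.
  by rewrite ler_nat ltnS.
by apply: nearW => k; apply: invariant_le => //; rewrite invr_gt0.
Qed.

Lemma invariant_unique (mu nu : probability (X * borel K)%type R) :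
  (forall E, measurable E -> mu (F @^-1` E) = mu E) ->
  (forall E, measurable E -> nu (F @^-1` E) = nu E) ->
  (forall C, measurable C -> mu (fst @^-1` C) = nu (fst @^-1` C)) ->
  forall E, measurable E -> mu E = nu E.
Proof.
move=> mui nui mn; apply: prod_measure_unique_open.
  by apply: le_lt_trans (ltry 1); exact: probability_le1.
move=> C U mC oU; apply/le_anti/andP; split; apply: invariant_le_open => //.
by move=> B mB; rewrite mn.
Qed.

End fibre_contraction.

(** * Leafwise norms of a disintegrated probability *)

(** A charge with nonnegative values is its own positive part.  The statements
    are about measurable sets only, where charges and measures are
    determined. *)
Section positive_charge.
Context d (T : measurableType d) (R : realType).
Context (nu : {charge set T -> \bar R}) (rho : {measure set T -> \bar R}).
Hypothesis nu_rho : forall E, measurable E -> nu E = rho E.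

Let nuN E : measurable E -> nu (E `&` hahn_neg nu) = 0%E.
Proof.
move=> mE; have [_ [mN negN] _ _] := hahnP nu.
have mEN : measurable (E `&` hahn_neg nu) by exact: measurableI.
apply/eqP; rewrite eq_le; apply/andP; split; last by rewrite nu_rho.
by apply: negN => //; exact: subIsetr.
Qed.

Lemma cneg_positive E : measurable E -> cneg nu E = 0%E.
Proof.
move=> mE; rewrite -[cneg nu E]/(jordan_neg (hahnP nu) E) jordan_negE.
rewrite cjordan_negE /crestr0 mem_set// /crestr.
by rewrite nuN// oppe0.
Qed.

Lemma cpos_positive E : measurable E -> cpos nu E = rho E.
Proof.
move=> mE; have := jordan_decomp (hahnP nu) mE.
rewrite -nu_rho// => ->; rewrite /cadd /= cscaleN1.
by rewrite [X in (_ - X)%E](cneg_positive mE) sube0.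
Qed.

Lemma cintegral_positive (g : T -> R) :
  cintegral nu g = (\int[rho]_x (g x)%:E)%E.
Proof.
rewrite /cintegral (@eq_measure_integral _ _ _ setT rho (cpos nu)); last first.
  by move=> E mE _; exact: cpos_positive.
rewrite (@eq_measure_integral _ _ _ setT mzero (cneg nu)); last first.
  by move=> E mE _; exact: cneg_positive.
by rewrite integral_measure_zero sube0.
Qed.

End positive_charge.

(** The constant function 1 is the optimal test function. *)
Lemma wnorm_probability (R : realType) (K : pmetricType R)
    (nu : {charge set (borel K) -> \bar R}) (rho : probability (borel K) R) :
  (forall E, measurable E -> nu E = rho E) -> wnorm nu = 1%E.
Proof.
move=> nu_rho.
have i1 : (\int[rho]_x cst 1 x)%E = 1%E.
  by rewrite integral_cst// mul1e; exact: probability_setT.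
 apply/eqP; rewrite eq_le; apply/andP; split.
  apply: ge_ereal_sup => _ [g [gL g1] <-]; rewrite (cintegral_positive nu_rho).
  have mg : measurable_fun [set: borel K] g.
    by apply: (@measurable_lipschitz _ _ _ 1) => x y; rewrite mul1r.
  apply: le_trans (le_abse_integral _ _ _) _ => //; first exact/measurable_EFinP.
  apply: (@le_trans _ _ (\int[rho]_x cst 1 x)%E).
    apply: ge0_le_integral => //.
      by apply/measurable_EFinP; exact: measurableT_comp.
    by move=> x _ /=; rewrite lee_fin.
  by rewrite i1.
apply: ereal_sup_ubound; exists (fun=> 1).
  by split=> [x y|x]; rewrite ?subrr ?normr0 ?mdist_ge0// normr1.
by rewrite (cintegral_positive nu_rho) i1 abse1.
Qed.

Section norms.
Local Open Scope ereal_scope.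
Context (R : realType) (n : nat) (A : aperiodicMx n)
  (theta : {itv R & `]0, 1[}%R) (K : pmetricType R).
Local Notation S := (borel (sft theta A)).
Local Notation SK := (borel (sft theta A) * borel K)%type.
Context (m : probability S R).

(** To be applied to a probability and to its positive and negative parts: as
    charges these need not be equal to the expected ones outside measurable
    sets, but their densities are determined up to a null set. *)
Lemma density_cst (mu : {charge set SK -> \bar R}) (c : R) :
  (forall C, measurable C -> mu (fst @^-1` C) = c%:E * m C) ->
  push1 mu `<< m /\ \forall x \ae m, density m mu x = c%:E.
Proof.
move=> muc.
have dom : push1 mu `<< m.
  apply/null_content_dominatesP => C mC mC0.
  by rewrite /push1 /cpushforward /= /pushforward muc// mC0 mule0.
split => //.
have : ae_eq m setT (Radon_Nikodym (push1 mu) m) (cst c%:E).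
  apply: integral_ae_eq => //.
    exact: Radon_Nikodym_integrable.
  move=> E _ mE; rewrite -Radon_Nikodym_integral// integral_cst//.
  by rewrite /push1 /cpushforward /= /pushforward muc.
by apply: filterS => x; exact.
Qed.

Section disintegrated.
Context (mu0 : probability SK R) (k : S -> probability SK R).
Hypothesis mu0_fst : forall C, measurable C -> mu0 (fst @^-1` C) = m C.
Hypothesis k_leaf : forall x, k x ([set x] `*` setT) = 1.
Hypothesis mk : forall E, measurable E -> measurable_fun setT (k ^~ E).
Hypothesis mu0k : forall E, measurable E -> mu0 E = \int[m]_x k x E.
Let M := charge_of_finite_measure mu0.

Let M_E E : measurable E -> M E = mu0 E. Proof. by []. Qed.

Let mfst C : measurable C -> measurable (fst @^-1` C : set SK).
Proof. by move=> mC; rewrite -[X in measurable X]setTI; exact: measurable_fst. Qed.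

Let dens : push1 M `<< m /\ \forall x \ae m, density m M x = 1.
Proof. by apply: density_cst => C mC; rewrite mul1e -mu0_fst. Qed.

Let dens_pos : push1 (charge_of_finite_measure (cpos M)) `<< m /\
  \forall x \ae m, density m (charge_of_finite_measure (cpos M)) x = 1.
Proof.
apply: density_cst => C mC; rewrite mul1e -mu0_fst//=.
by rewrite (cpos_positive M_E)//; exact: mfst.
Qed.

Let dens_neg : push1 (charge_of_finite_measure (cneg M)) `<< m /\
  \forall x \ae m, density m (charge_of_finite_measure (cneg M)) x = 0.
Proof.
apply: density_cst => C mC; rewrite mul0e /=.
by rewrite (cneg_positive M_E)//; exact: mfst.
Qed.

Lemma disintegration_cpos : is_disintegration m (cpos M) k.
Proof.
split.
- by apply: nearW => x _; exact: k_leaf.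
- by move=> E mE; exact: mk.
- move=> E mE; rewrite (cpos_positive M_E)// [LHS](mu0k mE).
  apply: ae_eq_integral => //; first exact: mk.
    apply: emeasurable_funM; first exact: mk.
    by apply: measurable_int; apply: Radon_Nikodym_integrable; exact: dens_pos.1.
  by apply: filterS dens_pos.2 => x dx _; rewrite dx mule1.
Qed.

(** Whichever disintegration is chosen in the definition of [leaf_restr_pos], on
    almost every leaf it gives a probability for the positive part, scaled by
    the density 1, and zero for the negative part, whose density is 0. *)
Lemma wnorm_leaf_restr : \forall x \ae m, wnorm (leaf_restr m M x) = 1.
Proof.
apply: filterS2 dens_pos.2 dens_neg.2 => x dp dn.
rewrite /leaf_restr.
have neg0 B : measurable B -> leaf_restr_pos m (cneg M) x B = 0.
  move=> mB; rewrite /leaf_restr_pos; case: pselect => [h|h] /=; last by [].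
  by rewrite /cscale dn mul0e.
have [rho rhoE] : exists rho : probability (borel K) R,
    forall B, measurable B -> leaf_restr_pos m (cpos M) x B = rho B.
  rewrite /leaf_restr_pos; case: pselect => [h|[]]; last first.
    by exists k; exact: disintegration_cpos.
  exists (image_prob measurable_snd (projT1 (cid h) x)) => B mB.
  by rewrite /= /cscale dp mul1e.
apply: (@wnorm_probability _ _ _ rho) => B mB.
by rewrite /= /cadd /= rhoE// /copp /= /cscale neg0// ?mule0 ?oppe0 adde0.
Qed.

Lemma Linf_norm_disintegrated : Linf_norm m M = 1.
Proof.
rewrite /Linf_norm (eq_ess_sup (g := cst 1) wnorm_leaf_restr) ess_sup_cst//.
by rewrite [ltRHS](@probability_setT _ _ _ m) lte01.
Qed.

Lemma in_AB_disintegrated : in_AB m M.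
Proof. by split; [exact: dens_pos.1|exact: dens_neg.1]. Qed.

Let lip_cst : lip_const ((fun=> 1%R) : sft theta A -> R) = 0.
Proof.
rewrite /lip_const; apply/eqP; rewrite eq_le; apply/andP; split.
  by apply: ge_ereal_sup => _ [x _ [y _ <-]]; rewrite subrr normr0 mul0r.
by apply: ereal_sup_ubound; exists point => //; exists point => //; rewrite subrr normr0 mul0r.
Qed.

Let lip1 : is_lip_version m M (fun=> 1%R).
Proof. by split; [rewrite /lipschitz_fun lip_cst ltry|exact: dens.2]. Qed.

Lemma in_Sinf_disintegrated : in_Sinf m M.
Proof.
split; last by exists (fun=> 1%R); exact: lip1.
by split; [exact: in_AB_disintegrated|rewrite Linf_norm_disintegrated ltry].
Qed.

Lemma Sinf_norm_disintegrated : Sinf_norm m M = 2%:E.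
Proof.
rewrite /Sinf_norm Linf_norm_disintegrated.
suff -> : ereal_inf [set lip_norm phi | phi in [set phi | is_lip_version m M phi]] = 1.
  by rewrite -EFinD.
apply/eqP; rewrite eq_le; apply/andP; split.
  apply: ereal_inf_lbound; exists (fun=> 1%R); first exact: lip1.
  rewrite /lip_norm lip_cst adde0; apply/eqP; rewrite eq_le; apply/andP; split.
    by apply: ge_ereal_sup => _ [x _ <-]; rewrite normr1.
  by apply: ereal_sup_ubound; exists point => //; rewrite normr1.
apply: le_ereal_inf_tmp => _ [phi [_ phiE] <-].
have [x phix] : exists x, phi x = 1%R.
  have : \forall x \ae m, phi x = 1%R.
    by apply: filterS2 phiE dens.2 => x -> [].
  move=> [N [mN N0 subN]]; apply: contrapT => /forallNP nx.
  have NT : N = setT by apply/seteqP; split=> // x _; exact/subN/nx.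
  have : m setT = 1 by exact: probability_setT.
  by rewrite -NT N0 => /eqP; rewrite eq_sym onee_eq0.
rewrite /lip_norm -[leLHS]adde0; apply: leeD.
  by apply: ereal_sup_ubound; exists x => //; rewrite phix normr1.
by apply: ereal_sup_ubound; exists point => //; exists point => //; rewrite subrr normr0 mul0r.
Qed.

End disintegrated.
End norms.

(** * The theorem *)

Theorem theorem1 (R : realType) (n : nat) (A : aperiodicMx n)
  (theta : {itv R & `]0, 1[}) (m : probability (borel (sft theta A)) R)
  (m_markov : is_markov m)
  (K : pmetricType R) (K_compact : compact [set: K])
  (K_diam : diam K = 1%:E)
  (G : (borel (sft theta A) * borel K)%type -> borel K)
  (G_meas : measurable_fun [set: (borel (sft theta A) * borel K)%type] G)
  (G_contr : exists2 alpha : R, 0 < alpha < 1 &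
    \forall x \ae m, forall y1 y2 : K,
      mdist (G (x, y1) : K) (G (x, y2)) <= alpha * mdist y1 y2) :
  exists mu0 : probability (borel (sft theta A) * borel K)%type R,
    [/\ invariant_measure (skew_product G) mu0 /\ in_Sinf m (charge_of_finite_measure mu0),
        (forall mu : probability (borel (sft theta A) * borel K)%type R,
           invariant_measure (skew_product G) mu -> in_Sinf m (charge_of_finite_measure mu) ->
           forall E, measurable E -> mu E = mu0 E),
        Linf_norm m (charge_of_finite_measure mu0) = 1%:E &
        Sinf_norm m (charge_of_finite_measure mu0) = 2%:E].
Proof.
have [P [p [[P_ge0 _] P_gt0 [p_ge0 p_sum1] pP m_cyl]]] := m_markov.
have p_gt0 := stationary_gt0 P_gt0 P_ge0 p_ge0 p_sum1 pP.
have cyl_pos := cyl_gt0 P_gt0 P_ge0 p_ge0 p_sum1 pP m_cyl.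
set S := borel (sft theta A) in G G_meas G_contr *.
pose sh : S -> S := @sft_shift R theta n A.
have msh : measurable_fun setT sh by exact: measurable_shift.
pose Th := backward_step (theta := theta) P_gt0 P_ge0 p_gt0 pP.
have mTh : measurable_fun setT Th by exact: measurable_backward_step.
have shTh w : sh (Th w).1 = w.1 by exact: shift_backward_step.
have pTh := backward_step_preserves P_gt0 P_ge0 p_gt0 pP m_cyl.
have m_inv := section_shift_invariant msh shTh pTh.
have K_le1 (y z : K) : mdist y z <= 1.
  rewrite -lee_fin -K_diam; apply: ereal_sup_ubound.
  by exists y => //; exists z.
have [alpha alpha01 [N [mN N0 GN]]] := G_contr.
(* contracts every leaf, and differs from [G] on negligibly many leaves *)
pose G' (z : S * borel K) : borel K := if z.1 \in N then point else G z.
have mG' : measurable_fun setT G'.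
  apply: measurable_fun_ifT => //.
  apply: (@measurableT_comp _ _ _ _ _ _ (fun x : S => x \in N)) measurable_fst.
  apply: (measurable_fun_bool true); rewrite setTI.
  rewrite (_ : _ @^-1` _ = N); first exact: mN.
  by apply/seteqP; split => x /=; [exact: set_mem|exact: mem_set].
have G'_contr (x : S) (y z : K) : mdist (G' (x, y) : K) (G' (x, z)) <= alpha * mdist y z.
  rewrite /G' /=; case: ifPn => [_|xN].
    by rewrite mdistxx mulr_ge0 ?mdist_ge0//; case/andP: alpha01 => /ltW.
  apply: contrapT => h; move/negP: xN; apply; apply/mem_set/GN => /= Gx.
  by apply: h; exact: Gx.
pose F := skew_product G; pose F' (z : S * borel K) : S * borel K := (sh z.1, G' z).
have mfstN : measurable (fst @^-1` N : set (S * borel K)).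
  by rewrite -[X in measurable X]setTI; exact: measurable_fst.
have mF (H : S * borel K -> borel K) : measurable_fun setT H ->
    measurable_fun setT (fun z : S * borel K => (sh z.1, H z)).
  move=> mH; apply/measurable_fun_pairP; split => //.
  exact: measurableT_comp msh measurable_fst.
have FF' (rho : probability (S * borel K)%type R) E :
    (forall C, measurable C -> rho (fst @^-1` C) = m C) -> measurable E ->
    rho (F @^-1` E) = rho (F' @^-1` E).
  move=> rho_fst mE; apply: (@measure_eq_off _ _ _ _ _ _ (fst @^-1` N)) => //.
  - by rewrite -[X in measurable X]setTI; exact: mF.
  - by rewrite -[X in measurable X]setTI; exact: mF.
  - by transitivity (m N); [exact: rho_fst|exact: N0].
  - apply/seteqP; split => -[x y] [/= Exy xN]; split => //; move: Exy.
      by rewrite /F' /G' /= memNset.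
    by rewrite /F' /G' /= memNset.
have [Y mY YTh] := invariant_section K_compact K_le1 mG' alpha01 G'_contr mTh.
pose mu0 := graph_measure m (@unif01 R) mY.
have mu0_fst C : measurable C -> mu0 (fst @^-1` C) = m C by exact: graph_measure_fst.
have mu0_inv := graph_measure_invariant msh mG' mY mTh shTh pTh YTh.
have k_leaf := graph_kernel_leaf (@unif01 R) mY.
have mk := measurable_graph_kernel (@unif01 R) mY.
have mu0k := graph_measure_int m (@unif01 R) mY.
exists mu0; split.
- split; first by move=> E mE; rewrite /pushforward FF'//; exact: mu0_inv.
  apply: (in_Sinf_disintegrated mu0_fst k_leaf) => [E mE|E mE]; [exact: mk|exact: mu0k].
- move=> mu mu_inv [[[mu_dom _] _] [phi [/lipschitz_fun_bound[L L0 phiL] phiE]]].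
  pose nu := image_prob measurable_fst mu.
  have nu_dom : push1 (charge_of_finite_measure mu) `<< m.
    apply/null_content_dominatesP => C mC mC0.
    have /null_content_dominatesP /(_ C mC mC0) := mu_dom.
    rewrite /push1 /cpushforward /= /pushforward.
    rewrite (@cpos_positive _ _ _ _ mu)//.
    by rewrite -[X in measurable X]setTI; exact: measurable_fst.
  have nuE E : measurable E -> nu E = (\int[m]_(x in E) (phi x)%:E)%E.
    move=> mE; transitivity (\int[m]_(x in E) density m (charge_of_finite_measure mu) x)%E.
      by rewrite /density -Radon_Nikodym_integral.
    apply: ae_eq_integral => //.
    + exact/measurable_funTS/measurable_int/Radon_Nikodym_integrable.
    + apply/measurable_EFinP/measurable_funTS.
      exact: measurable_lipschitz phiL.
    + by apply: filterS phiE => x ->.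
  have nu_inv E : measurable E -> nu (sh @^-1` E) = nu E.
    move=> mE; apply: (mu_inv (fst @^-1` E)).
    by rewrite -[X in measurable X]setTI; exact: measurable_fst.
  have mu_fst C : measurable C -> mu (fst @^-1` C) = m C.
    exact: (invariant_lipschitz_density cyl_pos m_inv nu_inv L0 phiL nuE).
  apply: (invariant_unique msh K_le1 mG' alpha01 G'_contr) => //.
  + by move=> E mE; rewrite -FF'//; exact: mu_inv.
  + by move=> C mC; rewrite mu_fst// mu0_fst.
- by apply: (Linf_norm_disintegrated mu0_fst k_leaf) => [E mE|E mE]; [exact: mk|exact: mu0k].
- by apply: (Sinf_norm_disintegrated mu0_fst k_leaf) => [E mE|E mE]; [exact: mk|exact: mu0k].
Qed.
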